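(* For any $\epsilon>0$ there is $P(\epsilon)\in\mathbb{N}$ such that for every integer $p\ge P(\epsilon)$, the Ising pure $p$-spin Hamiltonian $H$ on $\Sigma_n=\{-1,1\}^n$ satisfies $$\mathbb{P}\left[(1-\epsilon)\sqrt{2\ln 2}\le\max_{\boldsymbol{\sigma}\in\Sigma_n}H(\boldsymbol{\sigma})\le\sqrt{2\ln 2}\right]\ge 1-o_n(1).$$
   Context: For $n\in\mathbb{N}$, $\Sigma_n=\{-1,1\}^n$. For a fixed integer $p\ge 2$, the Ising pure $p$-spin Hamiltonian is $$H(\boldsymbol{\sigma})=H_{n,p}(\boldsymbol{\sigma})=n^{-\frac{p+1}{2}}\sum_{1\le i_1,\dots,i_p\le n}J_{i_1,\dots,i_p}\boldsymbol{\sigma}_{i_1}\cdots\boldsymbol{\sigma}_{i_p},\qquad \boldsymbol{\sigma}\in\Sigma_n,$$ where $\boldsymbol{J}=(J_{i_1,\dots,i_p})_{1\le i_1,\dots,i_p\le n}$ has i.i.d. standard normal entries. The probability is with respect to $\boldsymbol{J}$, and $o_n(1)$ denotes a quantity tending to $0$ as $n\to\infty$ with $p,\epsilon$ fixed. *)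

(* Defs.v *)
From HB Require Import structures.
From mathcomp Require Export all_boot all_order all_algebra.
From mathcomp Require Export all_classical all_reals all_analysis.
Export Order.TTheory GRing.Theory Num.Theory numFieldNormedType.Exports.

Set Implicit Arguments.
Unset Strict Implicit.
Unset Printing Implicit Defensive.

Local Open Scope classical_set_scope.
Local Open Scope ring_scope.

Definition mutually_independent (I : finType) (d : measure_display)
    (T : measurableType d) (R : realType) (P : probability T R)
    (X : I -> {RV P >-> R}) : Prop :=
  forall (A : {set I}) (B : I -> set R), (forall i, measurable (B i)) ->
    P (\bigcap_(i in [set` A]) (X i @^-1` B i)) =
    (\prod_(i in A) P (X i @^-1` B i))%E.

Definition standard_normal (d : measure_display) (T : measurableType d)
    (R : realType) (P : probability T R) (X : {RV P >-> R}) : Prop :=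
  forall B : set R, measurable B -> distribution P X B = normal_prob 0 1 B.

(* A configuration of {-1, 1}^n is encoded by a boolean-valued function; its
   i-th coordinate as a real number is [spin s i]: -1 at true, 1 at false. *)
Definition config (n : nat) := {ffun 'I_n -> bool}.

Definition spin (R : realType) (n : nat) (s : config n) (i : 'I_n) : R :=
  (-1) ^+ s i.

(* A multi-index (i_1, ..., i_p) is a function 'I_p -> 'I_n. *)
Definition multi_index (n p : nat) := {ffun 'I_p -> 'I_n}.

Definition hamiltonian (R : realType) (n p : nat) (J : multi_index n p -> R)
    (s : config n) : R :=
  n%:R `^ (- ((p%:R + 1) / 2)) *
    \sum_(i : multi_index n p) J i * \prod_(k < p) spin R s (i k).

(* Since the base value is itself one of the values of f, this is the genuine
   maximum, also when all values of f are negative. *)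
Definition max_config (R : realType) (n : nat) (f : config n -> R) : R :=
  \big[Num.max/f [ffun=> false]]_(s : config n) f s.

(* Main.v *)
Require Import Defs.
From mathcomp Require Import ring lra measurable_realfun.

Set Implicit Arguments.
Unset Strict Implicit.
Unset Printing Implicit Defensive.

Local Open Scope classical_set_scope.
Local Open Scope ring_scope.

(** The energies are jointly Gaussian: each [hamiltonian J s] is centred of
    variance [1 / n], and the correlation of two of them is the [p]-th power of
    the normalised overlap [(overlap s t) / n] of the configurations. For large
    [p] this correlation is negligible unless the configurations nearly agree or
    are nearly opposite, so the [2 ^ n] energies behave almost as if they were
    independent, and the maximum of independent ones is close to
    [Num.sqrt (2 * ln 2)].

    Upper bound ([prob_sum_above]): by the sharp tail estimate
    [gauss_prob_tail], each energy exceeds [Num.sqrt (2 * ln 2)] with probability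
    at most [2 ^- n] times a factor of order [n ^ (- 1 / 2)]; a union bound over
    the [2 ^ n] configurations suffices.

    Lower bound ([prob_sum_below]): Chebyshev's inequality ([second_moment]) for
    the number of configurations whose energy, divided by its standard deviation,
    lies in a window [[t, t + 1]] with [t = (1 - eps) * Num.sqrt (2 * n * ln 2)].
    One has to show that the average over all pairs of configurations of the
    probability that both energies lie in the window, divided by its value for
    independent energies, is at most [1 + o(1)]. Counting energies in a bounded
    window, rather than all energies above [t], makes this a pointwise comparison
    of densities.

    For the joint law of two energies, the sum of the disorder variables over the
    multi-indices on which the two sign patterns agree, and the sum over the
    others, are independent Gaussian variables [U] and [V], and the two energies
    are [U + V] and [U - V] up to a common factor ([signed_sum_pair]). Comparing
    the product density of [(U, V)] with the isotropic one of the same total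
    variance, and rotating by 45 degrees, bounds the ratio above by the
    exponential of [3 * n] times the absolute correlation ([gauss_prob_pair]).

    The average over pairs ([sum_pair_weight]) splits according to the absolute
    overlap [D]. If [D] is at most [n] to the power 3/4, then [n * (D / n) ^+ p]
    tends to 0 uniformly and the ratio is [1 + o(1)]. Up to [r0 * n], with [r0]
    slightly less than 1, the exponent [3 * n * (D / n) ^+ p] is at most
    [D ^+ 2 / (12 * n)] because [p] is large, while the proportion of such
    configurations is at most [2 * expR (- D ^+ 2 / (6 * n))]. Beyond [r0 * n]
    the ratio is at most the reciprocal of the probability of the window, which
    is [2 ^ n] times an exponentially small quantity, and [r0] is chosen so close
    to 1 that the proportion of such configurations nearly compensates [2 ^ n]. *)

(** * Gaussian measures on the line *)

Section affine.
Variable R : realType.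
Local Notation mu := (@lebesgue_measure R).
Variables (c d : R) (c0 : c != 0).

Let phi : measurableTypeR R -> measurableTypeR R := fun x => c * x + d.

Let mphi : measurable_fun setT phi.
Proof. by apply: measurable_funD => //; apply: measurable_funM. Qed.

Let pf : {measure set (measurableTypeR R) -> \bar R} :=
  measure_function_pushforward__canonical__measure_function_Measure mu mphi.

Let nu := mscale (NngNum (normr_ge0 c)) pf.

Lemma lebesgue_measure_affine (A : set R) : measurable A ->
  mu A = (`|c|%:E * mu ((fun x => c * x + d)%R @^-1` A))%E.
Proof.
move=> mA; apply: (@lebesgue_measure_unique _ nu) => // _ [[a b]] _ <-.
transitivity (`|c|%:E * mu (phi @^-1` `]a, b]))%E; last by [].
have [cp|cn] := ltP 0 c.
  have -> : phi @^-1` `]a, b] = `](a - d) / c, (b - d) / c]%classic.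
    apply/seteqP; split => x; rewrite /phi/= !in_itv/= ltr_pdivrMr// ler_pdivlMr//.
      by rewrite ltrBlDr lerBrDr mulrC.
    by rewrite ltrBlDr lerBrDr mulrC.
  rewrite !lebesgue_measure_itv/= !lte_fin ltr_pM2r ?invr_gt0// ltrD2r.
  case: ifPn => ab; last by rewrite mule0.
  rewrite gtr0_norm// -!EFinD -EFinM; congr EFin; field.
  by rewrite gt_eqF.
have {}cn : c < 0 by rewrite lt_neqAle c0.
have -> : phi @^-1` `]a, b] = `[(b - d) / c, (a - d) / c[%classic.
  apply/seteqP; split => x; rewrite /phi/= !in_itv/= ltr_ndivlMr// ler_ndivrMr//.
    by rewrite ltrBlDr lerBrDr mulrC andbC.
  by rewrite ltrBlDr lerBrDr mulrC andbC.
rewrite !lebesgue_measure_itv/= !lte_fin ltr_nM2r ?invr_lt0// ltrD2r.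
case: ifPn => ab; last by rewrite mule0.
rewrite ltr0_norm// -!EFinD -EFinM; congr EFin; field.
by rewrite lt_eqF.
Qed.

Lemma ge0_integral_affine (f : R -> \bar R) : measurable_fun setT f ->
  (forall x, 0 <= f x)%E ->
  (\int[mu]_x f (c * x + d)%R = `|c|^-1%:E * \int[mu]_x f x)%E.
Proof.
move=> mf f0.
have -> : (\int[mu]_x f x = \int[nu]_x f x)%E.
  apply: eq_measure_integral => A mA _ /=; exact: lebesgue_measure_affine.
rewrite ge0_integral_mscale//= ge0_integral_pushforward//=.
rewrite muleA -EFinM mulVf ?normr_eq0// mul1e.
by rewrite preimage_setT.
Qed.

End affine.

(** The centred Gaussian law on the line, indexed by its variance [v] instead of
    its standard deviation, so that the parameters add up under convolution.
    For [v = 0] this is not a Dirac mass but the uniform law on [[0, 1]], hence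
    the recurring hypotheses [0 < v]. *)
Notation gauss_prob v := (normal_prob 0 (Num.sqrt v)).

Section gauss.
Variable R : realType.
Local Notation mu := (@lebesgue_measure R).
Implicit Types v a b x y : R.

(** The density of [gauss_prob v]. *)
Definition gauss v x : R :=
  (Num.sqrt (2 * pi * v))^-1 * expR (- x ^+ 2 / (2 * v)).

Lemma gauss_ge0 v x : 0 <= gauss v x.
Proof. by rewrite mulr_ge0 ?expR_ge0// invr_ge0 sqrtr_ge0. Qed.

Lemma measurable_gauss v : measurable_fun setT (gauss v).
Proof.
apply: measurable_funM => //; apply: measurableT_comp => //.
apply: measurable_funM => //; apply: measurableT_comp => //.
Qed.

Lemma normal_pdf_gauss v x : 0 < v -> normal_pdf 0 (Num.sqrt v) x = gauss v x.
Proof.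
move=> v0; rewrite normal_pdfE ?gt_eqF ?sqrtr_gt0// /normal_peak /normal_fun.
rewrite sqr_sqrtr ?ltW// subr0 /gauss; congr (_ ^-1 * expR (_ / _)); last by ring.
by congr Num.sqrt; ring.
Qed.

Lemma gauss_probE v (B : set R) : 0 < v ->
  gauss_prob v B = (\int[mu]_(x in B) (gauss v x)%:E)%E.
Proof.
by move=> v0; apply: eq_integral => x _; rewrite normal_pdf_gauss.
Qed.

Lemma integral_gauss v : 0 < v -> (\int[mu]_x (gauss v x)%:E = 1)%E.
Proof.
move=> v0; rewrite -(integral_normal_pdf 0 (Num.sqrt v)).
by apply: eq_integral => x _; rewrite normal_pdf_gauss.
Qed.

Lemma ge0_integral_gauss_prob v (f : R -> \bar R) : 0 < v ->
  measurable_fun setT f -> (forall x, 0 <= f x)%E ->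
  (\int[gauss_prob v]_x f x = \int[mu]_x (f x * (gauss v x)%:E))%E.
Proof.
move=> v0 mf f0.
have dom : gauss_prob v `<< mu by exact: normal_prob_dominates.
rewrite -(Radon_Nikodym_SigmaFinite.change_of_variables dom)//.
apply: ae_eq_integral => //.
- apply: emeasurable_funM => //; apply: (measurable_int mu).
  exact: Radon_Nikodym_SigmaFinite.f_integrable.
- apply: emeasurable_funM => //; apply/measurable_EFinP; exact: measurable_gauss.
- apply: ae_eqe_mul2l => /=; apply: integral_ae_eq => //=.
  + exact: Radon_Nikodym_SigmaFinite.f_integrable.
  + by apply/measurable_EFinP; exact: measurable_gauss.
  + move=> E _ mE; rewrite -Radon_Nikodym_SigmaFinite.f_integral//.
    exact: gauss_probE.
Qed.

Lemma gauss_prodE a b (E : set (R * R)) : 0 < a -> 0 < b -> measurable E ->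
  ((gauss_prob a \x gauss_prob b) E =
   \int[mu]_x \int[mu]_y (gauss a x * gauss b y * \1_E (x, y))%:E)%E.
Proof.
move=> a0 b0 mE; rewrite /product_measure1 ge0_integral_gauss_prob//; last first.
  exact: (measurable_fun_xsection (gauss_prob b)).
apply: eq_integral => x _ /=.
rewrite gauss_probE// integral_mkcond muleC -ge0_integralZl//=; last 3 first.
- apply/(measurable_restrictT _ _).1.
    exact: measurable_xsection.
  by apply: measurable_funTS; apply/measurable_EFinP; exact: measurable_gauss.
- by move=> y _; rewrite erestrict_ge0// => z _; rewrite lee_fin gauss_ge0.
- by rewrite lee_fin gauss_ge0.
apply: eq_integral => y _; rewrite patchE indicE mem_xsection.
by case: ifP; rewrite -?EFinM ?(mulr1,mulr0)// mule0.
Qed.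

End gauss.

Section conv.
Variable R : realType.
Local Notation mu := (@lebesgue_measure R).
Implicit Types v a b x y : R.

(** Completing the square in [x]: the joint density of two independent centred
    Gaussian variables [X] and [Y - X] is the density of [Y] times the
    conditional density of [X] given [Y]. *)
Lemma gaussM_conv a b x y : 0 < a -> 0 < b ->
  gauss a x * gauss b (y - x) =
  gauss (a + b) y * gauss (a * b / (a + b)) (x - y * a / (a + b)).
Proof.
move=> a0 b0; have ab0 : 0 < a + b by rewrite addr_gt0.
have p0 := pi_gt0 R.
rewrite /gauss !(mulrACA _ (expR _)) -!expRD -!invfM -!sqrtrM; last 2 first.
- by rewrite ?mulr_ge0 ?ltW.
- by rewrite ?mulr_ge0 ?ltW.
congr (_ * expR _).
  by congr (Num.sqrt _)^-1; field; rewrite gt_eqF.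
by field; rewrite !gt_eqF.
Qed.

(** Invariance of the planar Gaussian density under the rotation by 45 degrees. *)
Lemma gaussM_rot a x y : 0 < a ->
  gauss (a / 2) x * gauss (a / 2) y = 2 * (gauss a (x + y) * gauss a (x - y)).
Proof.
move=> a0; have p0 := pi_gt0 R.
rewrite /gauss !(mulrACA _ (expR _)) -!expRD -!invfM -!expr2 !sqr_sqrtr; last 2 first.
- by rewrite ?mulr_ge0 ?ltW ?divr_gt0.
- by rewrite ?mulr_ge0 ?ltW.
rewrite [RHS]mulrA; congr (_ * expR _).
  by move: (@pi R) p0 => q q0; field; rewrite !gt_eqF.
by field; rewrite !gt_eqF.
Qed.

Lemma ge0_integral_rot (F : R -> R) : measurable_fun setT F ->
  (forall x, 0 <= F x) ->
  (\int[mu]_x \int[mu]_y (F (x + y)%R * F (x - y)%R)%:E =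
   2^-1%:E * (\int[mu]_x (F x)%:E * \int[mu]_x (F x)%:E))%E.
Proof.
move=> mF F0.
(* the inner variable [y] is replaced by [x + y] *)
transitivity (\int[mu]_x \int[mu]_y (F y * F (2 * x + - y))%:E)%E.
  apply: eq_integral => x _.
  rewrite -[RHS]mul1e -[1%E in RHS](_ : (`|1|^-1)%:E = _); last first.
    by rewrite normr1 invr1.
  rewrite -(ge0_integral_affine x (oner_neq0 R)); last 2 first.
  - apply/measurable_EFinP; apply: measurable_funM => //.
    by apply: measurableT_comp => //; apply: measurable_funD => //.
  - by move=> y; rewrite lee_fin mulr_ge0.
  by apply: eq_integral => y _; congr (_ * _)%:E; congr F; ring.
rewrite (@fubini_tonelli _ _ _ _ _ mu mu
    (fun z => (F z.2 * F (2 * z.1 + - z.2))%:E)); last 2 first.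
- apply/measurable_EFinP; apply: measurable_funM.
    exact: measurableT_comp.
  apply: measurableT_comp => //; apply: measurable_funB => //.
  exact: measurable_funM.
- by move=> z; rewrite lee_fin mulr_ge0.
transitivity (\int[mu]_y ((F y)%:E * (2^-1%:E * \int[mu]_x (F x)%:E)))%E.
  apply: eq_integral => y _ /=.
  under eq_integral do rewrite EFinM.
  rewrite ge0_integralZl//; last 3 first.
  - apply/measurable_EFinP; apply: measurableT_comp => //.
    by apply: measurable_funD => //; apply: measurable_funM.
  - by move=> x _; rewrite lee_fin.
  - by rewrite lee_fin.
  congr (_ * _)%E.
  have n2 : (2 : R) != 0 by [].
  rewrite (ge0_integral_affine (- y) n2 (f := fun x => (F x)%:E)); last 2 first.
  - exact/measurable_EFinP.
  - by move=> x; rewrite lee_fin.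
  by rewrite ger0_norm.
rewrite ge0_integralZr//; last 3 first.
- exact/measurable_EFinP.
- by move=> x _; rewrite lee_fin.
- by rewrite mule_ge0 ?lee_fin// integral_ge0// => x _; rewrite lee_fin.
by rewrite muleCA.
Qed.

Lemma gauss_prob_conv a b (C : set R) : 0 < a -> 0 < b -> measurable C ->
  (gauss_prob a \x gauss_prob b)%E [set z | C (z.1 + z.2)] =
  gauss_prob (a + b) C.
Proof.
move=> a0 b0 mC; have ab0 : 0 < a + b by rewrite addr_gt0.
have mE : measurable [set z : R * R | C (z.1 + z.2)].
  rewrite -[X in measurable X]setTI.
  by apply: (measurable_funD measurable_fst measurable_snd).
rewrite gauss_prodE//.
have mg v : measurable_fun setT (gauss v) := measurable_gauss v.
have g0 v x := gauss_ge0 v x.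
have mC1 : measurable_fun setT (\1_C : R -> R) by exact: measurable_indic.
(* the inner variable [y] is replaced by [x + y], then the order of integration
   is exchanged *)
transitivity (\int[mu]_x \int[mu]_y (gauss a x * gauss b (y - x) * \1_C y)%:E)%E.
  apply: eq_integral => x _.
  rewrite -[RHS]mul1e -[1%E in RHS](_ : (`|1|^-1)%:E = _); last first.
    by rewrite normr1 invr1.
  rewrite -(ge0_integral_affine x (oner_neq0 R)); last 2 first.
  - apply/measurable_EFinP; apply: measurable_funM => //.
    apply: measurable_funM => //.
    by apply: measurableT_comp => //; apply: measurable_funB => //.
  - by move=> y; rewrite lee_fin !mulr_ge0.
  apply: eq_integral => y _; congr (_ * gauss _ _ * _)%:E; first by ring.
  rewrite !indicE; congr (nat_of_bool _)%:R.
  by apply/idP/idP; rewrite !inE/= mul1r addrC.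
rewrite (@fubini_tonelli _ _ _ _ _ mu mu
    (fun z => (gauss a z.1 * gauss b (z.2 - z.1) * \1_C z.2)%:E)); last 2 first.
- apply/measurable_EFinP; apply: measurable_funM; last exact: measurableT_comp.
  apply: measurable_funM; first exact: (measurableT_comp (mg a) measurable_fst).
  by apply: measurableT_comp => //; apply: measurable_funB.
- by move=> z /=; rewrite lee_fin !mulr_ge0.
rewrite gauss_probE// [RHS]integral_mkcond.
apply: eq_integral => y _ /=.
under eq_integral => x _.
  rewrite gaussM_conv// (_ : _ * _ * _ = (gauss (a + b) y * \1_C y) *
    gauss (a * b / (a + b)) (1 * x + - (y * a / (a + b)))); last first.
    by rewrite mulrAC mul1r.
  rewrite EFinM; over.
rewrite ge0_integralZl//; last 3 first.
- apply/measurable_EFinP; apply: measurableT_comp => //.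
  by apply: measurable_funD => //; apply: measurable_funM.
- by move=> x _; rewrite lee_fin.
- by rewrite lee_fin mulr_ge0.
rewrite (ge0_integral_affine _ (oner_neq0 R)
   (f := fun x => (gauss (a * b / (a + b)) x)%:E)); last 2 first.
- exact/measurable_EFinP.
- by move=> x; rewrite lee_fin.
rewrite integral_gauss ?divr_gt0 ?mulr_gt0// normr1 invr1 !mule1 patchE indicE.
by case: ifP => _; rewrite ?mulr1 ?mulr0.
Qed.

End conv.

Section bounds.
Variable R : realType.
Local Notation mu := (@lebesgue_measure R).
Implicit Types v a b x y t N : R.

(** The factor [t^-1], better than the Chernoff bound, is what makes the union
    bound over all configurations tend to 0. The Gaussian density is compared on
    the half-line with the multiple of the exponential density of rate
    [t / Num.sqrt N] that is tangent to it at [t * Num.sqrt N]. *)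
Lemma gauss_prob_tail N t : 0 < N -> 0 < t ->
  (gauss_prob N `](t * Num.sqrt N)%R, +oo[ <= (expR (- t ^+ 2 / 2) / t)%:E)%E.
Proof.
move=> N0 t0; set s := Num.sqrt N.
have s0 : 0 < s by rewrite sqrtr_gt0.
have Ns : N = s ^+ 2 by rewrite sqr_sqrtr ?ltW.
have p0 := pi_gt0 R.
pose r := t / s; have r0 : 0 < r by rewrite divr_gt0.
pose c := t * s; have c0 : 0 < c by rewrite mulr_gt0.
pose K := (Num.sqrt (2 * pi * N))^-1 * expR (t ^+ 2 / 2) / r.
have K0 : 0 <= K by rewrite divr_ge0 ?(ltW r0)// mulr_ge0 ?expR_ge0// invr_ge0 sqrtr_ge0.
rewrite gauss_probE// -/c.
apply: (@le_trans _ _ (\int[mu]_(x in `]c, +oo[) (K%:E * (exponential_pdf r x)%:E))%E).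
  apply: ge0_le_integral => //.
  - by move=> x _; rewrite lee_fin gauss_ge0.
  - by apply/measurable_funTS/measurable_EFinP; exact: measurable_gauss.
  - apply/measurable_funTS/measurable_EFinP; apply: measurable_funM => //.
    exact: measurable_exponential_pdf.
  - move=> x /=; rewrite in_itv/= andbT => cx.
    have x0 : 0 <= x by rewrite ltW// (lt_trans c0).
    rewrite -EFinM lee_fin exponential_pdfE//.
    rewrite /K /gauss.
    rewrite [leRHS](_ : _ = (Num.sqrt (2 * pi * N))^-1 *
      (expR (t ^+ 2 / 2) * expR (- r * x))); last first.
      by field; rewrite !gt_eqF// sqrtr_gt0 !mulr_gt0.
    rewrite -expRD ler_wpM2l ?invr_ge0 ?sqrtr_ge0// ler_expR -subr_ge0.
    rewrite (_ : _ - _ = (x / s - t) ^+ 2 / 2); last first.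
      by rewrite /r Ns; field; rewrite gt_eqF.
    by rewrite divr_ge0 ?sqr_ge0.
rewrite ge0_integralZl//; last 2 first.
- by apply/measurable_funTS/measurable_EFinP; exact: measurable_exponential_pdf.
- by move=> x _; rewrite lee_fin exponential_pdf_ge0 ?ltW.
have -> : (\int[mu]_(x in `]c, +oo[) (exponential_pdf r x)%:E =
           exponential_prob r `]c, +oo[)%E by [].
have tail : (exponential_prob r `]c, +oo[ <= (expR (- r * c))%:E)%E.
  have me (D : set R) : measurable_fun D (EFin \o exponential_pdf r).
    by apply/measurable_funTS/measurable_EFinP; exact: measurable_exponential_pdf.
  have e0 x : (0 <= (exponential_pdf r x)%:E)%E.
    by rewrite lee_fin exponential_pdf_ge0 ?ltW.
  have := @ge0_subset_integral _ _ _ mu (`[0, c] `|` `]c, +oo[) setT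
     (measurableU _ _ (measurable_itv _) (measurable_itv _)) measurableT _
     (me setT) (fun x _ => e0 x) (@subsetT _ _).
  rewrite integral_exponential_pdf// ge0_integral_setU//=; last 2 first.
  - exact: me.
  - rewrite disj_set2E; apply/eqP/seteqP; split => // x [] /=.
    by rewrite !in_itv/= andbT => /andP[_ /le_lt_trans] /[apply]; rewrite ltxx.
  have := exponential_prob_itv0c r c0; rewrite /exponential_prob => ->.
  case: (\int[mu]_(x in `]c, +oo[) (exponential_pdf r x)%:E)%E => [z| |].
  - by rewrite -EFinB -EFinD !lee_fin; lra.
  - by rewrite -EFinB addey// leye_eq.
  - by move=> _; rewrite leNye.
have K0E : (0 <= K%:E)%E by rewrite lee_fin.
apply: (le_trans (lee_wpmul2l K0E tail)).
rewrite -EFinM lee_fin /K.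
rewrite [leLHS](_ : _ = (s / Num.sqrt (2 * pi * N)) * (expR (- t ^+ 2 / 2) / t)).
  apply: ler_piMl; first by rewrite divr_ge0 ?expR_ge0 ?(ltW t0).
  apply: ltW; rewrite ltr_pdivrMr ?sqrtr_gt0 ?mulr_gt0// mul1r ltr_sqrt ?mulr_gt0//.
  have := @pi_ge2 R; nra.
rewrite (_ : - r * c = - t ^+ 2); last first.
  by rewrite /r /c; field; rewrite gt_eqF.
rewrite [in LHS]mulrAC -[X in X / r]mulrA -expRD.
rewrite (_ : t ^+ 2 / 2 + - t ^+ 2 = - t ^+ 2 / 2); last by field.
by rewrite /r; field; rewrite !gt_eqF// sqrtr_gt0 !mulr_gt0.
Qed.

Lemma gauss_prob_window_ge N t : 0 < N -> 0 < t ->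
  ((expR (- (t + 1) ^+ 2 / 2) / 3)%:E <=
   gauss_prob N `[(t * Num.sqrt N)%R, ((t + 1) * Num.sqrt N)%R])%E.
Proof.
move=> N0 t0; set s := Num.sqrt N.
have s0 : 0 < s by rewrite sqrtr_gt0.
have Ns : N = s ^+ 2 by rewrite sqr_sqrtr ?ltW.
have p0 := pi_gt0 R.
pose K := (Num.sqrt (2 * pi * N))^-1 * expR (- (t + 1) ^+ 2 / 2).
have K0 : 0 <= K by rewrite mulr_ge0 ?expR_ge0// invr_ge0 sqrtr_ge0.
rewrite gauss_probE//.
apply: (@le_trans _ _ (\int[mu]_(x in `[(t * s)%R, ((t + 1) * s)%R]) K%:E)%E); last first.
  apply: ge0_le_integral => //.
  - by apply/measurable_funTS/measurable_EFinP; exact: measurable_gauss.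
  - move=> x /=; rewrite in_itv/= => /andP[x1 x2].
    rewrite lee_fin /K /gauss ler_wpM2l ?invr_ge0 ?sqrtr_ge0// ler_expR.
    rewrite !mulNr lerN2 ler_pdivrMr ?mulr_gt0//.
    rewrite (_ : _ * (2 * N) = ((t + 1) * s) ^+ 2); last by rewrite Ns; field.
    have t1 : 0 <= t + 1 by lra.
    rewrite ler_sqr ?nnegrE ?mulr_ge0 ?(ltW s0)//.
    by rewrite ltW// (lt_le_trans _ x1)// mulr_gt0.
rewrite integral_cst//= lebesgue_measure_itv/= lte_fin ltr_pM2r// ltrDl ltr01.
rewrite -EFinD -EFinM lee_fin /K.
rewrite [leRHS](_ : _ =
    expR (- (t + 1) ^+ 2 / 2) * (s / Num.sqrt (2 * pi * N))); last first.
  by ring.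
rewrite ler_wpM2l ?expR_ge0// ler_pdivlMr ?sqrtr_gt0 ?mulr_gt0//.
rewrite ler_pdivrMl//.
have -> : 3 * s = Num.sqrt ((3 * s) ^+ 2).
  by rewrite sqrtr_sqr ger0_norm// mulr_ge0// ltW.
apply: ler_wsqrtr; rewrite exprMn -Ns ler_wpM2r ?(ltW N0)//.
have := @pihalf_lt2 R; lra.
Qed.

End bounds.

Section pair.
Variable R : realType.
Local Notation mu := (@lebesgue_measure R).
Implicit Types v a b x y t N : R.

Lemma onem_expR2_ge1 (x : R) : 0 <= x <= 1 / 2 -> 1 <= expR (2 * x) * (1 - x).
Proof.
move=> /andP[x0 x2]; have := expR_ge1Dx (2 * x); nra.
Qed.

(** With [a + b] fixed, the product density with variances [a] and [b] exceeds
    the isotropic one by at most an exponential factor, linear in the imbalance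
    [`|a - b| / (a + b)], as long as both arguments are at most
    [w * Num.sqrt (a + b)]. The normalising constants contribute the summand 2
    in the exponent; of the two quadratic terms one only helps. *)
Lemma gaussM_le a b w u v : 0 < a -> 0 < b ->
  `|a - b| / (a + b) <= 1 / 2 ->
  u ^+ 2 <= w ^+ 2 * (a + b) -> v ^+ 2 <= w ^+ 2 * (a + b) ->
  gauss a u * gauss b v <=
  expR ((w ^+ 2 + 2) * (`|a - b| / (a + b))) *
    (gauss ((a + b) / 2) u * gauss ((a + b) / 2) v).
Proof.
move=> a0 b0; have N0 : 0 < a + b by rewrite addr_gt0.
set d := `|a - b| / (a + b) => d2 uw vw.
have d0 : 0 <= d by rewrite divr_ge0 ?normr_ge0 ?(ltW N0).
have p0 := pi_gt0 R.
have dN : `|a - b| = d * (a + b) by rewrite /d divfK// gt_eqF.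
have absE : (a - b <= `|a - b|) && (- (a - b) <= `|a - b|).
  by rewrite ler_norm -normrN ler_norm.
have sqE : (a - b) ^+ 2 = (d * (a + b)) ^+ 2 by rewrite -dN real_normK ?num_real.
rewrite /gauss !(mulrACA _ (expR _)) -!expRD -!invfM -!expr2 sqr_sqrtr; last first.
  by rewrite ?mulr_ge0 ?ltW ?divr_gt0.
have -> : expR ((w ^+ 2 + 2) * d) = expR (2 * d) * expR (w ^+ 2 * d).
  by rewrite -expRD mulrDl addrC.
rewrite [leRHS]mulrACA.
apply: ler_pM.
- by rewrite invr_ge0 mulr_ge0 ?sqrtr_ge0.
- exact: expR_ge0.
- have X0 : 0 < Num.sqrt (2 * pi * a) * Num.sqrt (2 * pi * b).
    by rewrite mulr_gt0 ?sqrtr_gt0 ?mulr_gt0.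
  rewrite -[leLHS]mul1r ler_pdivrMr// mulrAC ler_pdivlMr ?mulr_gt0 ?divr_gt0//.
  rewrite mul1r -sqrtrM; last by apply: ltW; rewrite !mulr_gt0.
  have le1 : pi * (a + b) * (1 - d) <= Num.sqrt (2 * pi * a * (2 * pi * b)).
    rewrite -[leLHS]ger0_norm; last first.
      by rewrite mulr_ge0 ?mulr_ge0 ?(ltW p0) ?(ltW N0)// subr_ge0; lra.
    rewrite -sqrtr_sqr; apply: ler_wsqrtr.
    rewrite -subr_ge0.
    rewrite (_ : _ - _ = pi ^+ 2 *
        (4 * a * b - (a + b) ^+ 2 * (1 - d) ^+ 2)); last first.
      by move: (@pi R) => q; ring.
    rewrite mulr_ge0 ?sqr_ge0// subr_ge0.
    have -> : 4 * a * b = (a + b) ^+ 2 - (a - b) ^+ 2 by ring.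
    rewrite sqE -subr_ge0.
    rewrite (_ : _ - _ = (a + b) ^+ 2 * (2 * d * (1 - d))); last by ring.
    by apply: mulr_ge0; [exact: sqr_ge0 | apply: mulr_ge0; lra].
  have e1 : 1 <= expR (2 * d) * (1 - d) by apply: onem_expR2_ge1; rewrite d0.
  rewrite (_ : 2 * pi * ((a + b) / 2) = pi * (a + b)); last first.
    by move: (@pi R) => q; field.
  apply: (@le_trans _ _ (pi * (a + b) * (expR (2 * d) * (1 - d)))).
    by rewrite ler_peMr// mulr_ge0 ?ltW.
  by rewrite mulrCA ler_wpM2l ?expR_ge0.
rewrite -expRD ler_expR.
have h1 : - u ^+ 2 / (2 * a) = - u ^+ 2 / (a + b) +
    (a - b) / a * (u ^+ 2 / (2 * (a + b))).
  by field; rewrite !gt_eqF.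
have h2 : - v ^+ 2 / (2 * b) = - v ^+ 2 / (a + b) +
    (b - a) / b * (v ^+ 2 / (2 * (a + b))).
  by field; rewrite !gt_eqF.
rewrite (mulrC 2 (_ / 2)) divfK//.
have key x c z : 0 < c -> x ^+ 2 <= w ^+ 2 * (a + b) -> 0 <= z -> z <= `|a - b| ->
    a + b <= 2 * c -> z / c * (x ^+ 2 / (2 * (a + b))) <= w ^+ 2 * d.
  move=> c0 xw z0 zd cN.
  apply: (@le_trans _ _ (2 * d * (w ^+ 2 / 2))); last by lra.
  apply: ler_pM.
  - by rewrite divr_ge0 ?(ltW c0).
  - by rewrite divr_ge0 ?sqr_ge0// mulr_ge0 ?(ltW N0).
  - by rewrite ler_pdivrMr//; nra.
  - by rewrite ler_pdivrMr ?mulr_gt0//; lra.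
have neg x c z : 0 < c -> z <= 0 -> z / c * (x ^+ 2 / (2 * (a + b))) <= 0.
  move=> c0 z0; rewrite mulr_le0_ge0//.
    by rewrite pmulr_lle0 ?invr_gt0.
  by rewrite divr_ge0 ?sqr_ge0// mulr_ge0 ?(ltW N0).
case/andP: absE => ab1 ab2.
have [ab|ba] := leP b a.
- have k := @key u a (a - b) a0 uw.
  have n := @neg v b (b - a) b0.
  have k' : (a - b) / a * (u ^+ 2 / (2 * (a + b))) <= w ^+ 2 * d by apply: k; lra.
  have n' : (b - a) / b * (v ^+ 2 / (2 * (a + b))) <= 0 by apply: n; lra.
  by lra.
- have k := @key v b (b - a) b0 vw.
  have n := @neg u a (a - b) a0.
  have k' : (b - a) / b * (v ^+ 2 / (2 * (a + b))) <= w ^+ 2 * d by apply: k; lra.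
  have n' : (a - b) / a * (u ^+ 2 / (2 * (a + b))) <= 0 by apply: n; lra.
  by lra.
Qed.

(** If [U] and [V] are independent centred Gaussian variables of variances [a]
    and [b], then [U + V] and [U - V] have variance [a + b] and correlation
    [(a - b) / (a + b)]; the lemma bounds the probability that both lie in a
    window by the probability for independent variables, times a factor close to
    1 when the correlation is small compared to [(t + 1) ^- 2]. *)
Lemma gauss_prob_pair a b t (W : set R) : 0 < a -> 0 < b -> 0 <= t ->
  `|a - b| / (a + b) <= 1 / 2 ->
  W = `[t * Num.sqrt (a + b), (t + 1) * Num.sqrt (a + b)]%classic ->
  ((gauss_prob a \x gauss_prob b)
     [set z | W (z.1 + z.2)%R /\ W (z.1 - z.2)%R] <=
   (expR (((t + 1) ^+ 2 + 2) * (`|a - b| / (a + b))))%:E *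
     (gauss_prob (a + b)%R W * gauss_prob (a + b)%R W))%E.
Proof.
move=> a0 b0 t0 d2 WE; have N0 : 0 < a + b by rewrite addr_gt0.
set s := Num.sqrt (a + b) in WE; have s0 : 0 < s by rewrite sqrtr_gt0.
have Ns : a + b = s ^+ 2 by rewrite sqr_sqrtr ?ltW.
have mW : measurable W by rewrite WE.
set K := expR _; have K0 : 0 <= K by exact: expR_ge0.
pose F x := gauss (a + b) x * \1_W x.
have F0 x : 0 <= F x by rewrite mulr_ge0 ?gauss_ge0.
have mF : measurable_fun setT F.
  by apply: measurable_funM; [exact: measurable_gauss|exact: measurable_indic].
have FE : gauss_prob (a + b) W = (\int[mu]_x (F x)%:E)%E.
  rewrite gauss_probE// integral_mkcond; apply: eq_integral => x _.
  by rewrite patchE /F indicE; case: ifP => _; rewrite ?mulr1 ?mulr0.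
have mE : measurable [set z : R * R | W (z.1 + z.2) /\ W (z.1 - z.2)].
  apply: measurableI.
    rewrite -[X in measurable X]setTI.
    by apply: (measurable_funD measurable_fst measurable_snd).
  rewrite -[X in measurable X]setTI.
  by apply: (measurable_funB measurable_fst measurable_snd).
have mG : measurable_fun setT (fun z : R * R => (F (z.1 + z.2) * F (z.1 - z.2))%:E).
  apply/measurable_EFinP; apply: measurable_funM.
    by apply: measurableT_comp => //; apply: measurable_funD.
  by apply: measurableT_comp => //; apply: measurable_funB.
rewrite gauss_prodE// FE.
have -> : (K%:E * (\int[mu]_x (F x)%:E * \int[mu]_x (F x)%:E) =
    \int[mu]_x \int[mu]_y ((2 * K)%:E * (F (x + y)%R * F (x - y)%R)%:E))%E.
  under [RHS]eq_integral => x _.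
    rewrite ge0_integralZl//; last 3 first.
    - exact: (measurableT_comp mG (pair1_measurable x)).
    - by move=> y _; rewrite lee_fin mulr_ge0.
    - by rewrite lee_fin mulr_ge0.
    over.
  rewrite ge0_integralZl//; last 3 first.
  - apply: (measurable_fun_fubini_tonelli_F (m2 := mu) _ mG) => z.
  by rewrite ?mule_ge0 ?lee_fin ?mulr_ge0 ?gauss_ge0.
  - by move=> x _; apply: integral_ge0 => y _; rewrite lee_fin mulr_ge0.
  - by rewrite lee_fin mulr_ge0.
  rewrite ge0_integral_rot// [RHS]muleA -EFinM; congr (_%:E * _)%E.
  by field.
have mH : measurable_fun setT (fun z : R * R =>
    (gauss a z.1 * gauss b z.2 *
      \1_[set z | W (z.1 + z.2) /\ W (z.1 - z.2)] (z.1, z.2))%:E).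
  apply/measurable_EFinP; apply: measurable_funM; last first.
    under eq_fun do rewrite -surjective_pairing.
    exact: measurable_indic.
  apply: measurable_funM.
    exact: (measurableT_comp (measurable_gauss a) measurable_fst).
  exact: (measurableT_comp (measurable_gauss b) measurable_snd).
have H0 x y : 0 <= gauss a x * gauss b y *
      \1_[set z | W (z.1 + z.2) /\ W (z.1 - z.2)] (x, y).
  by rewrite !mulr_ge0 ?gauss_ge0.
have mG2 : measurable_fun setT (fun z : R * R =>
   ((2 * K)%:E * (F (z.1 + z.2) * F (z.1 - z.2))%:E)%E).
  exact: measurable_funeM.
apply: ge0_le_integral => //.
- by move=> x _; apply: integral_ge0 => y _; rewrite lee_fin.
- apply: (measurable_fun_fubini_tonelli_F (m2 := mu) _ mH) => z.
  by rewrite ?mule_ge0 ?lee_fin ?mulr_ge0 ?gauss_ge0.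
- apply: (measurable_fun_fubini_tonelli_F (m2 := mu) _ mG2) => z.
  by rewrite ?mule_ge0 ?lee_fin ?mulr_ge0 ?gauss_ge0.
move=> x _; apply: ge0_le_integral => //.
- by move=> y _; rewrite lee_fin.
- exact: (measurableT_comp mH (pair1_measurable x)).
- exact: (measurableT_comp mG2 (pair1_measurable x)).
move=> y _; rewrite -EFinM lee_fin indicE.
case: (boolP ((x, y) \in _)) => [|_]; last first.
  by rewrite mulr0 mulr_ge0// mulr_ge0.
rewrite inE/= => -[W1 W2].
rewrite mulr1 /F !indicE !mem_set//= !mulr1.
have Ng : 2 * K * (gauss (a + b) (x + y) * gauss (a + b) (x - y)) =
   K * (gauss ((a + b) / 2) x * gauss ((a + b) / 2) y).
  by rewrite gaussM_rot//; ring.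
rewrite Ng; move: W1 W2; rewrite WE/= !in_itv/= => /andP[l1 u1] /andP[l2 u2].
apply: gaussM_le => //.
  rewrite Ns -exprMn ler_sqr ?nnegrE; nra.
rewrite Ns -exprMn -subr_ge0 subr_sqr mulr_ge0//; nra.
Qed.

End pair.

(** * Sums of independent Gaussian variables *)

Section joint.
Context d (T : measurableType d) (R : realType) (P : probability T R).

(** Independence of two variables, and of the event [F] from them, tested on
    rectangles, determines the joint law on all measurable sets of the plane. *)
Lemma joint_law_unique (F : set T) (U V : T -> R)
    (Q1 Q2 : probability (measurableTypeR R) R) :
  measurable F -> measurable_fun setT U -> measurable_fun setT V ->
  (forall C D : set R, measurable C -> measurable D ->
     P (F `&` (U @^-1` C `&` V @^-1` D)) = (P F * (Q1 C * Q2 D))%E) ->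
  forall E : set (R * R), measurable E ->
    P (F `&` [set w | E (U w, V w)]) = (P F * (Q1 \x Q2) E)%E.
Proof.
move=> mF mU mV H E mE.
pose phi : T -> measurableTypeR R * measurableTypeR R := fun w => (U w, V w).
have mphi : measurable_fun setT phi by exact: measurable_fun_pair.
have mphiE : measurable (phi @^-1` E) by rewrite -[X in measurable X]setTI; exact: mphi.
have [PF0|PF0] := eqVneq (P F) 0%E.
  rewrite PF0 mul0e; apply/eqP; rewrite eq_le measure_ge0 andbT -PF0.
  by apply: le_measure; rewrite ?inE//; exact: (measurableI _ _ mF mphiE).
have PFfin : P F \is a fin_num by exact: fin_num_measure.
have c0 : 0 <= (fine (P F))^-1 by rewrite invr_ge0 fine_ge0.
have fPF : fine (P F) != 0 by rewrite -eqe fineK.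
pose m0 : {measure set T -> \bar R} := mrestr P mF.
pose pf : {measure set (measurableTypeR R * measurableTypeR R) -> \bar R} :=
  measure_function_pushforward__canonical__measure_function_Measure m0 mphi.
pose nu : {measure set (measurableTypeR R * measurableTypeR R) -> \bar R} :=
  mscale (NngNum c0) pf.
have nuE A : nu A = ((fine (P F))^-1%:E * P (F `&` phi @^-1` A))%E.
  by rewrite setIC.
rewrite (@product_measure_unique _ _ _ _ _ Q1 Q2 nu)//; last first.
  move=> A B mA mB; rewrite nuE.
  have -> : phi @^-1` (A `*` B) = U @^-1` A `&` V @^-1` B by [].
  by rewrite H// muleA -[X in (_ * X * _)%E](fineK PFfin) -EFinM mulVf// mul1e.
by rewrite nuE muleA -[X in (X * _ * _)%E](fineK PFfin) -EFinM divff// mul1e.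
Qed.

End joint.

Section sums.
Context d (T : measurableType d) (R : realType) (P : probability T R).
Context (I : finType) (X : I -> T -> R) (mX : forall i, measurable_fun setT (X i)).

(** The event [F] and the variables [X i] for [i] in [A] are independent, and
    these variables are standard Gaussian. Nothing is asserted if [P F] is 0. *)
Definition indep_gauss (F : set T) (A : {set I}) := forall B : I -> set R,
  (forall i, measurable (B i)) ->
  P (F `&` \bigcap_(i in [set` A]) (X i @^-1` B i)) =
  (P F * \prod_(i in A) gauss_prob 1 (B i))%E.

Lemma measurable_preX i (B : set R) : measurable B -> measurable (X i @^-1` B).
Proof. by move=> mB; rewrite -[X in measurable X]setTI; exact: mX. Qed.

Lemma indep_gauss1 F (A : {set I}) i (B : set R) : indep_gauss F A -> i \in A ->
  measurable B -> P (F `&` X i @^-1` B) = (P F * gauss_prob 1 B)%E.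
Proof.
move=> FA iA mB; pose B' j := if j == i then B else setT.
have mB' j : measurable (B' j) by rewrite /B'; case: ifP.
have := FA B' mB'; rewrite (bigD1 i)//= {2}/B' eqxx big1 ?mule1; last first.
  by move=> j /andP[_ ji]; rewrite /B' (negbTE ji) probability_setT.
move=> <-; congr (P (F `&` _)); apply/seteqP; split => w /=.
  by move=> Bw j _; rewrite /B'; case: eqP => [->|].
by move=> /(_ i iA); rewrite /B' eqxx.
Qed.

Lemma indep_gaussD1 F (A : {set I}) i (B : set R) : indep_gauss F A -> i \in A ->
  measurable B -> indep_gauss (F `&` X i @^-1` B) (A :\ i).
Proof.
move=> FA iA mB B0 mB0; rewrite (indep_gauss1 FA)//.
pose B' j := if j == i then B else B0 j.
have mB' j : measurable (B' j) by rewrite /B'; case: ifP.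
have := FA B' mB'; rewrite (big_setD1 i)//= {2}/B' eqxx -muleA.
rewrite (eq_bigr (fun j => gauss_prob 1 (B0 j))); last first.
  by move=> j; rewrite !inE /B' => /andP[/negbTE ->].
move=> <-; congr (P _); rewrite -setIA; congr (F `&` _).
apply/seteqP; split => w /=.
  move=> [Bw H] j jA; rewrite /B'; case: eqP => [->//|/eqP ji].
  by apply: H => /=; rewrite !inE ji.
move=> H; split; first by have := H i iA; rewrite /B' eqxx.
move=> j /=; rewrite !inE => /andP[ji jA].
by have := H j jA; rewrite /B' (negbTE ji).
Qed.

Lemma measurable_sumX (A : {set I}) :
  measurable_fun setT (fun w => \sum_(i in A) X i w).
Proof.
by under eq_fun do rewrite -big_enum; exact: measurable_sum.
Qed.

(** A sum of [#|A|] independent standard Gaussian variables is Gaussian of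
    variance [#|A|], and independent of [F]. Carrying the event [F] along makes
    the induction on [A] work: the last variable is absorbed into [F]. *)
Lemma indep_gauss_sum F (A : {set I}) (C : set R) : measurable F ->
  A != finset.set0 -> indep_gauss F A -> measurable C ->
  P (F `&` [set w | C (\sum_(i in A) X i w)]) =
  (P F * gauss_prob (#|A|%:R) C)%E.
Proof.
move Ak : #|A| => k; elim: k => [|k IH] in F A C Ak *.
  by move=> _; rewrite -card_gt0 Ak.
move=> mF _ FA mC.
have [i iA] : exists i, i \in A by apply/card_gt0P; rewrite Ak.
have := cardsD1 i A; rewrite Ak iA add1n => -[Ak'].
have [A'0|A'0] := eqVneq (A :\ i) finset.set0.
  rewrite A'0 cards0 in Ak'; rewrite Ak'.
  rewrite -(indep_gauss1 FA iA)//; congr (P (F `&` _)).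
  by apply/funext => w /=; rewrite (big_setD1 i)//= A'0 big_set0 addr0.
have k0 : (0 < k)%N by rewrite Ak' card_gt0.
have := @joint_law_unique _ _ _ P F (fun w => \sum_(j in A :\ i) X j w) (X i)
   (gauss_prob k%:R) (gauss_prob 1) mF (measurable_sumX _) (mX i) _
   [set z | C (z.1 + z.2)].
rewrite gauss_prob_conv ?ltr0n// -natr1 => <-.
- by congr (P (F `&` _)); apply/funext => w /=; rewrite (big_setD1 i)//= addrC.
- move=> D B mD mB; rewrite setIA setIAC.
  have mFB : measurable (F `&` X i @^-1` B).
    by apply: measurableI => //; exact: measurable_preX.
  have := IH _ _ D (esym Ak') mFB A'0 (indep_gaussD1 FA iA mB) mD.
  rewrite (indep_gauss1 FA)// => IHE.
  by rewrite (muleC (gauss_prob k%:R D)) muleA -IHE.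
- rewrite -[X in measurable X]setTI.
  by apply: (measurable_funD measurable_fst measurable_snd).
Qed.

End sums.

Lemma gauss_probN (R : realType) (v : R) (B : set R) : 0 < v -> measurable B ->
  gauss_prob v (-%R @^-1` B) = gauss_prob v B.
Proof.
move=> v0 mB; rewrite !gauss_probE// integral_mkcond [RHS]integral_mkcond.
have n1 : (-1 : R) != 0 by rewrite oppr_eq0 oner_eq0.
have := ge0_integral_affine 0 n1 (f := (fun x => (gauss v x)%:E) \_ B).
rewrite normrN1 invr1 mul1e => <-.
- apply: eq_integral => x _; rewrite mulN1r addr0 !patchE.
  rewrite (_ : (x \in _) = (- x \in B)); last by apply/idP/idP; rewrite !inE.
  by rewrite /gauss sqrrN.
- apply/(measurable_restrictT _ _).1 => //.
  by apply/measurable_funTS/measurable_EFinP; exact: measurable_gauss.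
- by move=> x; rewrite erestrict_ge0// => z _; rewrite lee_fin gauss_ge0.
Qed.

Section signed.
Context d (T : measurableType d) (R : realType) (P : probability T R).
Context (I : finType) (J : I -> {RV P >-> R}).
Hypothesis Jind : mutually_independent J.
Hypothesis Jnorm : forall i, standard_normal (J i).

Lemma indep_gauss_signed (c : I -> R) (A : {set I}) : (forall i, `|c i| = 1) ->
  indep_gauss P (fun i w => c i * J i w) setT A.
Proof.
move=> c1 B mB.
have mcB i : measurable ((fun x => c i * x) @^-1` B i).
  rewrite -[X in measurable X]setTI.
  by apply: (measurable_funM (measurable_cst (c i)) (@measurable_id _ _ _)).
have := Jind A mcB; rewrite setTI probability_setT mul1e => ->.
apply: eq_bigr => i _; apply: (etrans (Jnorm i (mcB i))); rewrite sqrtr1.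
rewrite -{1}sqrtr1; have [c0|c0] := ltP (c i) 0.
  have -> : c i = -1 by apply: oppr_inj; rewrite opprK -(c1 i) ltr0_norm.
  rewrite -[in RHS]sqrtr1 -[RHS]gauss_probN//; congr (gauss_prob 1 _).
  by apply/funext => x /=; rewrite mulN1r.
have -> : c i = 1 by rewrite -(c1 i) ger0_norm.
rewrite sqrtr1; congr (normal_prob 0 1 _).
by apply/funext => x /=; rewrite mul1r.
Qed.

Variable c : I -> R.
Hypothesis c1 : forall i, `|c i| = 1.
Let S w := \sum_i c i * J i w.

Let mcJ i : measurable_fun setT (fun w => c i * J i w).
Proof. exact: measurable_funM. Qed.

Lemma signed_sum_law (C : set R) : (0 < #|I|)%N -> measurable C ->
  P (S @^-1` C) = gauss_prob #|I|%:R C.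
Proof.
move=> I0 mC.
have := indep_gauss_sum mcJ measurableT _ (indep_gauss_signed finset.setT c1) mC.
rewrite setTI probability_setT mul1e cardsT => <-.
  congr (P _); apply/funext => w /=; rewrite /S; congr C.
  by apply: eq_bigl => i; rewrite inE.
by rewrite -card_gt0 cardsT.
Qed.

End signed.

Section signed_pair.
Context d (T : measurableType d) (R : realType) (P : probability T R).
Context (I : finType) (J : I -> {RV P >-> R}).
Hypothesis Jind : mutually_independent J.
Hypothesis Jnorm : forall i, standard_normal (J i).
Variables c c' : I -> R.
Hypothesis c1 : forall i, `|c i| = 1.
Hypothesis c1' : forall i, `|c' i| = 1.

(** Two sums of the same standard Gaussian variables with signs [c] and [c'] are
    [U + V] and [U - V], where [U] collects the indices on which the signs agree
    and [V] the others; [U] and [V] are independent, and the difference of their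
    variances is the inner product of [c] and [c']. *)
Lemma signed_sum_pair t (W : set R) : 0 <= t ->
  `|\sum_i c i * c' i| / #|I|%:R <= 1 / 2 -> (0 < #|I|)%N ->
  W = `[t * Num.sqrt #|I|%:R, (t + 1) * Num.sqrt #|I|%:R]%classic ->
  (P [set w | W (\sum_i c i * J i w)%R /\ W (\sum_i c' i * J i w)%R] <=
   (expR (((t + 1) ^+ 2 + 2) * (`|\sum_i c i * c' i| / #|I|%:R)))%:E *
     (gauss_prob (#|I|%:R)%R W * gauss_prob (#|I|%:R)%R W))%E.
Proof.
move=> t0 D2 I0 WE.
pose A := [set i | c i == c' i]%SET.
have ccE i : c i * c' i = if i \in A then 1 else -1.
  rewrite inE; have [<-|cc] := eqVneq (c i) (c' i).
    by rewrite -expr2 -real_normK ?num_real// c1 expr1n.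
  have := c1 i; have := c1' i.
  case: (ger0P (c i)) cc => ?; case: (ger0P (c' i)) => ? /eqP.
  - by move=> cc e1 e2; case: cc; rewrite e1 e2.
  - by move=> _ e -> ; rewrite mul1r; lra.
  - by move=> _ -> e; rewrite mulr1; lra.
  - by move=> cc e1 e2; case: cc; lra.
have c'E i : c' i = if i \in A then c i else - c i.
  have cc : c i * c i = 1 by rewrite -expr2 -real_normK ?num_real// c1 expr1n.
  rewrite -[LHS]mul1r -cc -mulrA ccE; case: ifP; rewrite ?mulr1 ?mulrN1//.
have cardAC : #|I|%:R = #|A|%:R + #|~: A|%:R :> R.
  by rewrite -natrD cardsC.
have DE : \sum_i c i * c' i = #|A|%:R - #|~: A|%:R.
  rewrite (bigID (mem A))/= (eq_bigr (fun=> 1)); last first.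
    by move=> i iA; rewrite ccE iA.
  rewrite [X in _ + X](eq_bigr (fun=> -1)); last first.
    by move=> i /negbTE iA; rewrite ccE iA.
  rewrite !sumr_const; congr (_ + _); rewrite mulNrn; congr (- _%:R).
  by apply: eq_card => i; rewrite [RHS]finset.in_setC.
rewrite DE cardAC in D2 WE *.
have N0 : 0 < #|A|%:R + #|~: A|%:R :> R by rewrite -cardAC ltr0n.
rewrite ler_pdivrMr// in D2.
have nat_le (m n : nat) : `|m%:R - n%:R| <= 1 / 2 * (m%:R + n%:R) :> R ->
    0 < m%:R + n%:R :> R -> (0 < m)%N.
  case: m => // h1 h2; exfalso; move: h1 h2.
  by rewrite sub0r normrN ger0_norm// add0r => h1 h2; lra.
have A0 : (0 < #|A|)%N by exact: nat_le D2 _.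
have B0 : (0 < #|~: A|)%N.
  by apply: (nat_le _ #|A|); rewrite 1?distrC (addrC #|~: A|%:R).
have mcJ i : measurable_fun setT (fun w => c i * J i w) by exact: measurable_funM.
have mW : measurable W by rewrite WE.
pose U w := \sum_(i in A) c i * J i w.
pose V w := \sum_(i in ~: A) c i * J i w.
have mU : measurable_fun setT U by exact: measurable_sumX.
have mV : measurable_fun setT V by exact: measurable_sumX.
have UE B : measurable B -> P (U @^-1` B) = gauss_prob #|A|%:R B.
  move=> mB; have := indep_gauss_sum mcJ measurableT _
    (indep_gauss_signed Jind Jnorm A c1) mB.
  by rewrite setTI probability_setT mul1e => <-//; rewrite -card_gt0.
(* an event on [U] is independent of the variables indexed by the complement *)
have indU B : measurable B ->
    indep_gauss P (fun i w => c i * J i w) (U @^-1` B) (~: A).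
  move=> mB B' mB'; rewrite UE//.
  pose F := \bigcap_(i in [set` ~: A]) ((fun w => c i * J i w) @^-1` B' i).
  have mF : measurable F.
    by apply: fin_bigcap_measurable => // i _; exact: (measurable_preX mcJ).
  have FE : P F = (\prod_(i in ~: A) gauss_prob 1 (B' i))%E.
    have := indep_gauss_signed Jind Jnorm (~: A) c1 mB'.
    by rewrite setTI probability_setT mul1e.
  have indF : indep_gauss P (fun i w => c i * J i w) F A.
    move=> B'' mB''; rewrite FE.
    pose B3 i := if i \in A then B'' i else B' i.
    have mB3 i : measurable (B3 i) by rewrite /B3; case: ifP.
    have := indep_gauss_signed Jind Jnorm finset.setT c1 mB3.
    rewrite setTI probability_setT mul1e (bigID (mem A))/= muleC.
    rewrite (eq_bigl (mem (~: A))); last by move=> i; rewrite !inE.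
    rewrite (eq_bigr (gauss_prob 1 \o B')); last first.
      by move=> i /=; rewrite finset.in_setC /B3 => /negbTE ->.
    rewrite [X in _ = (_ * X)%E](eq_bigl (mem A)); last by move=> i; rewrite inE.
    rewrite [X in _ = (_ * X)%E](eq_bigr (gauss_prob 1 \o B'')); last first.
      by move=> i /= iA; rewrite /B3 iA.
    move=> <-; congr (P _); apply/seteqP; split => w /=.
      move=> [FA FB] i _; rewrite /B3 /=; case: ifP => iA; first exact: FB.
      by apply: FA => /=; rewrite inE iA.
    move=> H; split => i /= iA; have := H i; rewrite /B3 /= inE.
      by rewrite inE in iA; rewrite (negbTE iA); exact.
    by rewrite iA; exact.
  have := indep_gauss_sum mcJ mF _ indF mB; rewrite -card_gt0 => /(_ A0).
  by rewrite -FE setIC muleC.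
have jointUV := @joint_law_unique _ _ _ P setT U V (gauss_prob #|A|%:R)
  (gauss_prob #|~: A|%:R) measurableT mU mV.
have -> : [set w | W (\sum_i c i * J i w) /\ W (\sum_i c' i * J i w)] =
    setT `&` [set w | [set z | W (z.1 + z.2) /\ W (z.1 - z.2)] (U w, V w)].
  rewrite setTI; apply/funext => w /=.
  have -> : \sum_i c i * J i w = U w + V w.
    rewrite (bigID (mem A))/=; congr (_ + _).
    by apply: eq_bigl => i; rewrite finset.in_setC.
  suff -> : \sum_i c' i * J i w = U w - V w by [].
  rewrite (bigID (mem A))/=; congr (_ + _).
    by apply: eq_bigr => i iA; rewrite c'E iA.
  rewrite /V -sumrN; apply: eq_big => i; first by rewrite finset.in_setC.
  by move=> /negbTE iA; rewrite c'E iA mulNr.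
rewrite jointUV; last 2 first.
- move=> C D mC mD; rewrite setTI probability_setT mul1e.
  have mUC : measurable (U @^-1` C) by rewrite -[X in measurable X]setTI; exact: mU.
  have := indep_gauss_sum mcJ mUC _ (indU C mC) mD.
  by rewrite UE// => <-//; rewrite -card_gt0.
- apply: measurableI.
    rewrite -[X in measurable X]setTI.
    by apply: (measurable_funD measurable_fst measurable_snd).
  rewrite -[X in measurable X]setTI.
  by apply: (measurable_funB measurable_fst measurable_snd).
rewrite probability_setT mul1e.
apply: gauss_prob_pair => //; rewrite ?ltr0n//.
by rewrite ler_pdivrMr.
Qed.

End signed_pair.

(** * The second moment method *)

Section second_moment.
Context d (T : measurableType d) (R : realType) (P : probability T R).
Context (S : finType) (E : S -> set T).
Hypothesis mE : forall s, measurable (E s).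

Lemma integral_sum_indic (I : finType) (F : I -> set T) (k : R) : 0 <= k ->
  (forall i, measurable (F i)) ->
  (\int[P]_w (\sum_i k * \1_(F i) w)%:E = \sum_i k%:E * P (F i))%E.
Proof.
move=> k0 mF.
under eq_integral do rewrite -sumEFin.
rewrite ge0_integral_sum//; last 2 first.
- by move=> i; apply/measurable_EFinP; apply: measurable_funM.
- by move=> i w _; rewrite lee_fin mulr_ge0.
apply: eq_bigr => i _.
under eq_integral do rewrite EFinM.
rewrite ge0_integralZl//; last first.
  by apply/measurable_EFinP; exact: measurable_indic.
by rewrite integral_indic// setIT.
Qed.

(** The second moment method for the number [Z] of events that occur: if the
    average over all pairs of [P (E s `&` E t) / q ^+ 2] is at most [1 + B], then
    the probability that no event occurs is at most [B]. This is Chebyshev's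
    inequality for [Z]. *)
Lemma second_moment (q B : R) (m : S -> S -> R) : 0 < q -> (0 < #|S|)%N ->
  (forall s, P (E s) = q%:E) ->
  (forall s t, (P (E s `&` E t) <= (m s t * q ^+ 2)%:E)%E) ->
  \sum_s \sum_t m s t <= #|S|%:R ^+ 2 * (1 + B) ->
  (P (\bigcap_(s in [set: S]) ~` E s) <= B%:E)%E.
Proof.
move=> q0 S0 PE Pm mB.
set bad := \bigcap_(s in _) _.
have mbad : measurable bad.
  by apply: fin_bigcap_measurable => // s _; exact: measurableC.
pose M : R := #|S|%:R * q.
have M0 : 0 < M by rewrite mulr_gt0 ?ltr0n.
pose Z w : R := \sum_s \1_(E s) w.
(* with [M] the mean of [Z], this says [Z ^+ 2 - 2 * M * Z + M ^+ 2 >= M ^+ 2 * \1_bad];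
   it is arranged so that all terms are nonnegative *)
have key w : M ^+ 2 * \1_bad w + \sum_s 2 * M * \1_(E s) w <=
    \sum_(st : S * S) 1 * \1_(E st.1 `&` E st.2) w + M ^+ 2.
  have -> : \sum_(st : S * S) 1 * \1_(E st.1 `&` E st.2) w = Z w ^+ 2 :> R.
    rewrite -(pair_bigA _ (fun s t => 1 * \1_(E s `&` E t) w))/= expr2 mulr_suml.
    apply: eq_bigr => s _; rewrite mulr_sumr; apply: eq_bigr => t _.
    by rewrite mul1r indicI.
  rewrite -mulr_sumr -/(Z w) indicE.
  case: (boolP (w \in bad)) => wb /=; last first.
    by have := sqr_ge0 (Z w - M); rewrite mulr0; nra.
  have -> : Z w = 0.
    rewrite /Z big1// => s _; rewrite indicE memNset//.
    by rewrite inE in wb; exact: wb.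
  by rewrite mulr1 mulr0; lra.
have : (\int[P]_w (M ^+ 2 * \1_bad w + \sum_s 2 * M * \1_(E s) w)%:E <=
   \int[P]_w (\sum_(st : S * S) 1 * \1_(E st.1 `&` E st.2) w + M ^+ 2)%:E)%E.
  have mind (F : set T) : measurable F -> measurable_fun setT (\1_F : T -> R).
    by exact: measurable_indic.
  apply: ge0_le_integral => //.
  - move=> w _; rewrite lee_fin addr_ge0//; first by rewrite mulr_ge0 ?sqr_ge0.
    by apply: sumr_ge0 => s _; rewrite !mulr_ge0 ?(ltW q0) ?(ltW M0).
  - apply/measurable_EFinP; apply: measurable_funD.
      by apply: measurable_funM => //; exact: mind.
    by apply: measurable_sum => s; apply: measurable_funM => //; exact: mind.
  - apply/measurable_EFinP; apply: measurable_funD => //.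
    apply: measurable_sum => s; apply: measurable_funM => //.
    by apply: mind; exact: measurableI.
  - by move=> w _; rewrite lee_fin.
under eq_integral do rewrite EFinD EFinM.
under [X in (_ <= X)%E]eq_integral do rewrite EFinD.
rewrite ge0_integralD//; last 4 first.
- by move=> w _; rewrite -EFinM lee_fin mulr_ge0 ?sqr_ge0.
- apply/measurable_EFinP; apply: measurable_funM => //; exact: measurable_indic.
- by move=> w _; rewrite lee_fin sumr_ge0// => s _; rewrite !mulr_ge0 ?(ltW q0) ?(ltW M0).
- apply/measurable_EFinP; apply: measurable_sum => s.
  by apply: measurable_funM => //; exact: measurable_indic.
rewrite ge0_integralD//; last 3 first.
- by move=> w _; rewrite lee_fin; apply: sumr_ge0 => s _; rewrite !mulr_ge0.
- apply/measurable_EFinP; apply: measurable_sum => s.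
  apply: measurable_funM => //; apply: measurable_indic; exact: measurableI.
- by move=> w _; rewrite lee_fin sqr_ge0.
rewrite ge0_integralZl//; last 2 first.
- by apply/measurable_EFinP; exact: measurable_indic.
- by rewrite lee_fin sqr_ge0.
rewrite integral_indic// setIT integral_cst//.
have -> : ((M ^+ 2)%:E * P setT = (M ^+ 2)%:E)%E by rewrite probability_setT mule1.
rewrite !integral_sum_indic//; last 2 first.
- by move=> st; exact: measurableI.
- by rewrite mulr_ge0 ?(ltW q0) ?(ltW M0).
have -> : (\sum_s (2 * M)%:E * P (E s) = (2 * M ^+ 2)%:E)%E.
  rewrite (eq_bigr (fun=> (2 * M * q)%:E)); last by move=> s _; rewrite PE.
  by rewrite sumEFin sumr_const -mulr_natl; congr EFin; rewrite /M; ring.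
have le2 : (\sum_(st : S * S) 1%:E * P (E st.1 `&` E st.2) <=
    ((#|S|%:R ^+ 2 * (1 + B)) * q ^+ 2)%:E)%E.
  apply: (@le_trans _ _ (\sum_(st : S * S) (m st.1 st.2 * q ^+ 2)%:E)%E).
    by apply: lee_sum => st _; rewrite mul1e.
  rewrite sumEFin lee_fin -mulr_suml ler_wpM2r ?sqr_ge0//.
  by rewrite -(pair_bigA _ (fun s t => m s t)).
have bfin : P bad \is a fin_num by exact: fin_num_measure.
move=> /le_trans /(_ (leeD2r _ le2)).
have bE : P bad = (fine (P bad))%:E by rewrite fineK.
rewrite [X in (_ * X + _)%E]bE [X in _ -> (X <= _)%E]bE -EFinM -!EFinD !lee_fin => h.
have Sr0 : 0 < #|S|%:R :> R by rewrite ltr0n.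
move: h; rewrite /M; set N : R := _%:R in Sr0 *; move=> h.
have h2 : (N * q) ^+ 2 * fine (P bad) <= (N * q) ^+ 2 * B by nra.
by rewrite ler_pM2l in h2 => //; rewrite exprn_gt0// mulr_gt0.
Qed.

End second_moment.

(** * Counting configurations by overlap *)

Section overlap.
Variable (R : realType) (n : nat).
Implicit Types s t : config n.

(** The inner product of two configurations, an integer between [- n] and [n]
    (not divided by [n]). *)
Definition overlap s t : R := \sum_i spin R s i * spin R t i.

Lemma spinE s i : spin R s i = if s i then -1 else 1.
Proof. by rewrite /spin; case: (s i). Qed.

Lemma sum_expR_overlap (l : R) t :
  \sum_s expR (l * overlap s t) = (expR l + expR (- l)) ^+ n.
Proof.
have -> : (expR l + expR (- l)) ^+ n =
    \prod_(i < n) \sum_(b : bool) expR (l * ((-1) ^+ b * spin R t i)).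
  rewrite -[n in LHS]card_ord -prodr_const; apply: eq_bigr => i _.
  rewrite big_bool/= expr0 expr1 !mulN1r mul1r spinE.
  by case: (t i); rewrite ?opprK ?mulr1 ?mulrN1 // addrC.
rewrite bigA_distr_bigA; apply: eq_bigr => s _.
by rewrite /overlap mulr_sumr expR_sum.
Qed.

Lemma overlap_nat s t : exists2 k : nat, (k <= n)%N & `|overlap s t| = k%:R.
Proof.
pose z : int := \sum_i (-1) ^+ s i * (-1) ^+ t i.
have zE : overlap s t = z%:~R.
  rewrite /overlap /z rmorph_sum; apply: eq_bigr => i _.
  by rewrite rmorphM/= !rmorphXn/= rmorphN1.
exists `|z|%N; last by rewrite zE -intr_norm natr_absz.
rewrite -(ler_nat R) natr_absz intr_norm -zE /overlap.
apply: (le_trans (ler_norm_sum _ _ _)).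
rewrite (eq_bigr (fun=> 1)); last first.
  by move=> i _; rewrite normrM /spin !normrX !normrN1 !expr1n mul1r.
by rewrite sumr_const card_ord.
Qed.

(** Chernoff bound for the number of configurations whose overlap with [t] has
    absolute value at least [k]. *)
Lemma sum_overlap_ge (l k : R) t : 0 <= l ->
  \sum_s (k <= `|overlap s t|)%R%:R <=
  2 * (expR (- (l * k)) * (expR l + expR (- l)) ^+ n).
Proof.
move=> l0.
have -> : 2 * (expR (- (l * k)) * (expR l + expR (- l)) ^+ n) =
    \sum_s (expR (l * (overlap s t - k)) + expR (l * (- overlap s t - k))).
  rewrite big_split/= mulr_natl mulr2n; congr (_ + _).
    rewrite -(sum_expR_overlap _ t) mulr_sumr; apply: eq_bigr => s _.
    by rewrite -expRD mulrBr addrC.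
  have -> : expR l + expR (- l) = expR (- l) + expR (- - l) by rewrite opprK addrC.
  rewrite -(sum_expR_overlap _ t) mulr_sumr.
  apply: eq_bigr => s _.
  by rewrite -expRD mulrBr addrC mulrN mulNr.
apply: ler_sum => s _.
case: (boolP (k <= _)) => [kD|_] /=; last by rewrite addr_ge0 ?expR_ge0.
have [D0|D0] := leP 0 (overlap s t).
  rewrite ger0_norm// in kD.
  apply: (@le_trans _ _ (expR (l * (overlap s t - k)))).
    by rewrite -expR0 ler_expR mulr_ge0// subr_ge0.
  by rewrite lerDl expR_ge0.
rewrite ltr0_norm// in kD.
apply: (@le_trans _ _ (expR (l * (- overlap s t - k)))).
  by rewrite -expR0 ler_expR mulr_ge0// subr_ge0.
by rewrite lerDr expR_ge0.
Qed.

Lemma expR_sym_le (x : R) : 0 <= x <= 1 / 2 ->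
  expR x + expR (- x) <= 2 * expR (4 / 3 * x ^+ 2).
Proof.
move=> /andP[x0 x2].
apply: (@le_trans _ _ (2 * (1 + 4 / 3 * x ^+ 2))); last first.
  by rewrite ler_wpM2l// expR_ge1Dx.
have e1 : expR x * (1 - x) <= 1.
  apply: (@le_trans _ _ (expR x * expR (- x))).
    by rewrite ler_wpM2l ?expR_ge0// expR_ge1Dx.
  by rewrite -expRD subrr expR0.
have e2 : expR (- x) * (1 + x) <= 1.
  apply: (@le_trans _ _ (expR (- x) * expR x)).
    by rewrite ler_wpM2l ?expR_ge0// expR_ge1Dx.
  by rewrite -expRD addNr expR0.
have h1 : expR x <= 1 / (1 - x) by rewrite ler_pdivlMr//; lra.
have h2 : expR (- x) <= 1 / (1 + x) by rewrite ler_pdivlMr//; lra.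
apply: (le_trans (lerD h1 h2)).
rewrite [leLHS](_ : _ = 2 / (1 - x ^+ 2)); last first.
  field; apply/and3P; split; rewrite gt_eqF//; nra.
have y0 : 0 <= x ^+ 2 by exact: sqr_ge0.
have y1 : x ^+ 2 <= 1 / 4 by nra.
move: (x ^+ 2) y0 y1 => y y0 y1.
rewrite ler_pdivrMr; last lra.
nra.
Qed.

Lemma sum_overlap_ge_gauss (r : R) t : 0 <= r <= 1 ->
  \sum_s (r * n%:R <= `|overlap s t|)%R%:R <=
  2 * (2 ^+ n * expR (- (n%:R * r ^+ 2 / 6))).
Proof.
move=> /andP[r0 r1].
have l0 : 0 <= r / 4 by lra.
apply: (le_trans (sum_overlap_ge (r * n%:R) t l0)).
rewrite ler_wpM2l//.
have l2 : 0 <= r / 4 <= 1 / 2 by lra.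
apply: (@le_trans _ _ (expR (- (r / 4 * (r * n%:R))) *
   (2 * expR (4 / 3 * (r / 4) ^+ 2)) ^+ n)).
  rewrite ler_wpM2l ?expR_ge0//; apply: lerXn2r; rewrite ?nnegrE.
  - by rewrite addr_ge0 ?expR_ge0.
  - by rewrite mulr_ge0 ?expR_ge0.
  - exact: expR_sym_le.
rewrite exprMn -expRM_natl mulrCA -expRD ler_wpM2l ?exprn_ge0//.
rewrite ler_expR le_eqVlt; apply/orP; left; apply/eqP; by field.
Qed.

End overlap.

Section counting.
Variable (R : realType) (n p : nat) (eta w : R).
Hypothesis n0 : (0 < n)%N.
Hypothesis eta01 : 0 < eta <= 1.
Let r0 : R := 1 - eta ^+ 2 / 4.
Hypothesis p8 : (8 <= p)%N.
Hypothesis pr0 : 3 * r0 ^+ (p - 2) <= 1 / 12.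
Hypothesis wn : w ^+ 2 / 2 <= n%:R * (ln 2 - 2 * eta).

(** An upper bound for the probability that two configurations of overlap [D]
    both have their energy in the window, relative to the square of the
    probability for one configuration. The first case comes from the comparison
    of densities, with correlation [(D / n) ^+ p] and [w ^+ 2 + 2 <= 3 * n]; the
    second one ignores one of the two configurations. *)
Definition pair_weight (D : R) : R :=
  if `|D| / n%:R <= r0 then expR (3 * n%:R * (`|D| / n%:R) ^+ p)
  else 3 * expR (w ^+ 2 / 2).

Let nR0 : 0 < n%:R :> R. Proof. by rewrite ltr0n. Qed.
Let r01 : 0 <= r0 < 1.
Proof. by have /andP[e0 e1] := eta01; rewrite /r0; nra. Qed.

(** The proportion of configurations nearly equal or nearly opposite to [t] is
    exponentially smaller than the probability of the window, whose reciprocal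
    is at most [3 * expR (w ^+ 2 / 2)]. *)
Lemma sum_overlap_large (t : config n) :
  \sum_s (r0 * n%:R <= `|overlap R s t|)%R%:R * (3 * expR (w ^+ 2 / 2)) <=
  2 ^+ n * (6 * expR (- (eta * n%:R))) :> R.
Proof.
have /andP[e0 e1] := eta01.
(* this makes [l * (1 - r0) = eta / 2] and [expR (- (2 * l)) <= eta / 4] *)
pose l : R := 2 / eta; have l0 : 0 < l by rewrite divr_gt0.
rewrite -mulr_suml.
apply: (@le_trans _ _ ((2 * (expR (- (l * (r0 * n%:R))) * (expR l + expR (- l)) ^+ n)) *
   (3 * expR (n%:R * (ln 2 - 2 * eta))))).
  apply: ler_pM.
  - by apply: sumr_ge0.
  - by rewrite mulr_ge0 ?expR_ge0.
  - by apply: sum_overlap_ge; exact: ltW.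
  - by rewrite ler_wpM2l// ler_expR.
have h : expR (- (l * r0)) * (expR l + expR (- l)) <= expR (3 / 4 * eta).
  have -> : expR l + expR (- l) = expR l * (1 + expR (- (2 * l))).
    by rewrite mulrDr mulr1 -expRD; congr (_ + expR _); ring.
  rewrite mulrA -expRD (_ : - (l * r0) + l = eta / 2); last first.
    by rewrite /l /r0; field; rewrite gt_eqF.
  have -> : 3 / 4 * eta = eta / 2 + eta / 4 by field.
  rewrite [leRHS]expRD ler_wpM2l ?expR_ge0//.
  apply: (@le_trans _ _ (1 + eta / 4)); last exact: expR_ge1Dx.
  rewrite lerD2l expRN invf_ple ?posrE ?expR_gt0 ?divr_gt0//.
  apply: (@le_trans _ _ (2 * l)); last first.
    by apply: le_trans (expR_ge1Dx _); rewrite lerDr.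
  by rewrite le_eqVlt; apply/orP; left; apply/eqP; rewrite /l; field; rewrite gt_eqF.
have -> : 2 * (expR (- (l * (r0 * n%:R))) * (expR l + expR (- l)) ^+ n) =
    2 * (expR (- (l * r0)) * (expR l + expR (- l))) ^+ n.
  by rewrite [in RHS]exprMn -expRM_natl; congr (_ * (expR _ * _)); ring.
have -> : expR (n%:R * (ln 2 - 2 * eta)) = 2 ^+ n * expR (- (2 * eta)) ^+ n.
  by rewrite expRM_natl expRD lnK ?posrE// exprMn.
apply: (@le_trans _ _ (2 * expR (3 / 4 * eta) ^+ n *
    (3 * (2 ^+ n * expR (- (2 * eta)) ^+ n)))).
  apply: ler_wpM2r; first by rewrite !mulr_ge0 ?exprn_ge0 ?expR_ge0.
  apply: ler_wpM2l => //; apply: lerXn2r => //;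
    by rewrite nnegrE ?mulr_ge0 ?addr_ge0 ?expR_ge0.
have -> : 2 * expR (3 / 4 * eta) ^+ n * (3 * (2 ^+ n * expR (- (2 * eta)) ^+ n)) =
   2 ^+ n * (6 * (expR (3 / 4 * eta) ^+ n * expR (- (2 * eta)) ^+ n)) by ring.
rewrite -exprMn -expRD ler_wpM2l ?exprn_ge0// ler_wpM2l//.
rewrite -expRM_natl ler_expR.
have : 0 <= eta * n%:R by rewrite mulr_ge0 ?ltW.
lra.
Qed.

(* [k] exceeds [n] to the power 3/4 *)
Let atypical k := (n ^ 3 < k ^ 4)%N.

(** At a medium overlap [k] the Gaussian decay of the number of configurations
    beats the weight, which is at most [expR (k%:R ^+ 2 / (12 * n%:R))] because
    [p] is large. *)
Lemma sum_overlap_medium (t : config n) (k : nat) : (k <= n)%N ->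
  \sum_s (atypical k && (k%:R <= `|overlap R s t|)%R)%:R *
      expR (k%:R ^+ 2 / (12 * n%:R)) <=
  2 ^+ n * (2 * expR (- (Num.sqrt n%:R / 12))) :> R.
Proof.
move=> kn; rewrite -mulr_suml.
case: (boolP (atypical k)) => [kk|_] /=; last first.
  by rewrite big1// mul0r !mulr_ge0 ?exprn_ge0 ?expR_ge0.
pose r : R := k%:R / n%:R.
have r01' : 0 <= r <= 1.
  by rewrite divr_ge0//= ler_pdivrMr// mul1r ler_nat.
have rn : k%:R = r * n%:R by rewrite divfK ?gt_eqF.
have := sum_overlap_ge_gauss t r01'; rewrite -rn => h.
apply: (@le_trans _ _ (2 * (2 ^+ n * expR (- (n%:R * r ^+ 2 / 6))) *
   expR (k%:R ^+ 2 / (12 * n%:R)))).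
  by apply: ler_wpM2r => //; exact: expR_ge0.
have -> : 2 * (2 ^+ n * expR (- (n%:R * r ^+ 2 / 6))) * expR (k%:R ^+ 2 / (12 * n%:R)) =
   2 ^+ n * (2 * (expR (- (n%:R * r ^+ 2 / 6)) * expR (k%:R ^+ 2 / (12 * n%:R)))).
  ring.
rewrite -expRD ler_wpM2l ?exprn_ge0// ler_wpM2l// ler_expR.
rewrite (_ : _ + _ = - (k%:R ^+ 2 / n%:R / 12)); last first.
  by rewrite /r; field; rewrite gt_eqF.
rewrite lerN2 ler_wpM2r// ler_pdivlMr//.
rewrite -ler_sqr ?nnegrE ?mulr_ge0 ?sqrtr_ge0 ?sqr_ge0 ?(ltW nR0)//.
rewrite exprMn sqr_sqrtr ?(ltW nR0)// -exprS -exprM -!natrX ler_nat.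
exact: ltnW.
Qed.

(** Small overlaps contribute the first term, medium ones a term of the sum, and
    large ones the last term. *)
Lemma pair_weight_le (s t : config n) :
  pair_weight (overlap R s t) <= expR (3 / n%:R) +
   \sum_(k < n.+1) (atypical k && (k%:R <= `|overlap R s t|)%R)%:R *
      expR (k%:R ^+ 2 / (12 * n%:R)) +
   (r0 * n%:R <= `|overlap R s t|)%R%:R * (3 * expR (w ^+ 2 / 2)).
Proof.
have sum_ge0 : 0 <= \sum_(k < n.+1) (atypical k && (k%:R <= `|overlap R s t|)%R)%:R *
      expR (k%:R ^+ 2 / (12 * n%:R)) :> R.
  by apply: sumr_ge0 => k _; rewrite mulr_ge0 ?expR_ge0.
rewrite /pair_weight; case: ifPn => [Dr|]; last first.
  rewrite -ltNge ltr_pdivlMr// => /ltW ->; rewrite mul1r.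
  by rewrite -[leLHS]add0r lerD2r addr_ge0 ?expR_ge0.
have [k kn kE] := overlap_nat R s t.
rewrite kE in Dr *.
set x := k%:R / n%:R in Dr *.
have x0 : 0 <= x by rewrite divr_ge0.
have x1 : x <= 1 by have /andP[_ /ltW] := r01; exact: le_trans.
have last0 : 0 <= (r0 * n%:R <= k%:R)%R%:R * (3 * expR (w ^+ 2 / 2)).
  by rewrite !mulr_ge0 ?expR_ge0.
have [kt|kt] := leqP (k ^ 4) (n ^ 3).
  apply: (@le_trans _ _ (expR (3 / n%:R))); last first.
    by rewrite -addrA lerDl addr_ge0//; move: sum_ge0; rewrite kE.
  rewrite ler_expR -mulrA ler_wpM2l//.
  have x4 : x ^+ 4 <= n%:R^-1.
    rewrite /x expr_div_n ler_pdivrMr ?exprn_gt0//.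
    rewrite (_ : n%:R^-1 * n%:R ^+ 4 = n%:R ^+ 3); last first.
      by field; rewrite gt_eqF.
    by rewrite -!natrX ler_nat.
  have x8 : x ^+ p <= x ^+ 4 * x ^+ 4.
    by rewrite -exprD; apply: ler_wiXn2l.
  apply: (@le_trans _ _ (n%:R * (n%:R^-1 * n%:R^-1))); last first.
    by rewrite mulrA divff ?gt_eqF// mul1r.
  rewrite ler_wpM2l ?(ltW nR0)//; apply: (le_trans x8).
  by apply: ler_pM => //; rewrite exprn_ge0.
rewrite (bigD1 (Ordinal (kn : (k < n.+1)%N)))//= lexx andbT /atypical kt mul1r.
apply: (@le_trans _ _ (expR (k%:R ^+ 2 / (12 * n%:R)))).
  rewrite ler_expR.
  have -> : k%:R ^+ 2 / (12 * n%:R) = n%:R * (x ^+ 2 * (1 / 12)).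
    by rewrite /x; field; rewrite gt_eqF.
  have -> : 3 * n%:R * x ^+ p = n%:R * (x ^+ 2 * (3 * x ^+ (p - 2))).
    rewrite -{1}(subnKC (leq_trans (isT : (2 <= 8)%N) p8)) exprD; ring.
  rewrite ler_wpM2l ?(ltW nR0)// ler_wpM2l ?exprn_ge0//.
  apply: le_trans pr0; rewrite ler_wpM2l//.
  by apply: lerXn2r; rewrite ?nnegrE//; have /andP[] := r01.
set y := expR _.
rewrite -[leLHS]add0r -[leLHS]addr0; apply: lerD => //.
apply: lerD; first exact: expR_ge0.
by rewrite lerDl; apply: sumr_ge0 => i _; rewrite mulr_ge0 ?expR_ge0.
Qed.

Lemma sum_pair_weight (t : config n) :
  \sum_s pair_weight (overlap R s t) <=
  2 ^+ n * (expR (3 / n%:R) + n.+1%:R * (2 * expR (- (Num.sqrt n%:R / 12))) +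
     6 * expR (- (eta * n%:R))).
Proof.
apply: (le_trans (ler_sum _ (fun s _ => pair_weight_le s t))).
rewrite !big_split/= 2!mulrDr; apply: lerD; last exact: sum_overlap_large.
apply: lerD.
  rewrite sumr_const card_ffun card_bool card_ord -natrX [leRHS]mulr_natl.
  by rewrite lexx.
rewrite exchange_big/= mulrCA.
set y := 2 ^+ n * _.
have -> : n.+1%:R * y = \sum_(k < n.+1) y by rewrite sumr_const card_ord mulr_natl.
by apply: ler_sum => k _; apply: sum_overlap_medium; rewrite -ltnS.
Qed.

End counting.

(** * The maximum for a fixed size *)

Lemma prob_bigcup_fin_le d (T : measurableType d) (R : realType)
    (P : probability T R) (I : finType) (F : I -> set T) (c : R) :
  (forall i, measurable (F i)) -> (forall i, (P (F i) <= c%:E)%E) ->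
  (P (\bigcup_i F i) <= (#|I|%:R * c)%:E)%E.
Proof.
move=> mF Fc.
have -> : \bigcup_i F i = \big[setU/set0]_(i in I) F i.
  by rewrite -bigcup_pred; apply: eq_bigcupl; split => i //= _; rewrite inE.
apply: (@le_trans _ _ (\sum_(i in I) c%:E)%E); last first.
  by rewrite sumEFin sumr_const mulr_natl.
suff [//] : measurable (\big[setU/set0]_(i in I) F i) /\
  (P (\big[setU/set0]_(i in I) F i) <= \sum_(i in I) c%:E)%E.
elim/big_rec2 : _ => [|i x A _ [mA PA]]; first by rewrite measure0.
split; first exact: measurableU.
by apply: (le_trans (measureU2 _ (mF i) mA)); exact: (leeD (Fc i) PA).
Qed.

Section tensor.
Variables (R : realType) (n p : nat).
Implicit Types s t : config n.

(** The coefficient of the disorder variable [J i] in the Hamiltonian. *)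
Definition spin_prod s (i : multi_index n p) : R := \prod_(k < p) spin R s (i k).

Lemma norm_spin_prod s i : `|spin_prod s i| = 1.
Proof.
rewrite normr_prod big1// => k _.
by rewrite /spin normrX normrN1 expr1n.
Qed.

(** The covariance of the unnormalised energies is a power of the overlap. *)
Lemma sum_spin_prodM s t :
  \sum_i spin_prod s i * spin_prod t i = overlap R s t ^+ p.
Proof.
rewrite -[p in RHS]card_ord -prodr_const /overlap bigA_distr_bigA.
by apply: eq_bigr => i _; rewrite -big_split.
Qed.

Lemma card_multi_index : #|multi_index n p| = (n ^ p)%N.
Proof. by rewrite card_ffun !card_ord. Qed.

Lemma card_config : #|config n| = (2 ^ n)%N.
Proof. by rewrite card_ffun card_bool card_ord. Qed.

(** The unnormalised energy on the right has variance [n ^ p]; the Hamiltonian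
    itself has variance [1 / n]. *)
Lemma hamiltonianE (J : multi_index n p -> R) s : (0 < n)%N ->
  hamiltonian J s * (Num.sqrt n%:R * Num.sqrt (n ^ p)%:R) =
  \sum_i spin_prod s i * J i.
Proof.
move=> n0; have nr0 : 0 < n%:R :> R by rewrite ltr0n.
rewrite /hamiltonian mulrAC.
have -> : Num.sqrt n%:R * Num.sqrt (n ^ p)%:R = n%:R `^ ((p%:R + 1) / 2) :> R.
  rewrite -sqrtrM ?ler0n// -natrM -expnS natrX -powR12_sqrt ?exprn_ge0//.
  by rewrite -powR_mulrn// -powRrM -natr1.
rewrite -powRD; last by rewrite (gt_eqF nr0) implybT.
rewrite addNr powRr0 mul1r; apply: eq_bigr => i _; exact: mulrC.
Qed.

Lemma le_max_config (f : config n -> R) s : f s <= max_config f.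
Proof. exact: le_bigmax. Qed.

Lemma max_config_le (f : config n -> R) b : (forall s, f s <= b) ->
  max_config f <= b.
Proof. by move=> fb; apply: bigmax_le. Qed.

Lemma measurable_max_config d (T : measurableType d) (f : T -> config n -> R) :
  (forall s, measurable_fun setT (fun w => f w s)) ->
  measurable_fun setT (fun w => max_config (f w)).
Proof.
move=> mf; rewrite /max_config.
elim: (index_enum _) => [|s r IH].
  by under eq_fun do rewrite big_nil; exact: mf.
by under eq_fun do rewrite big_cons; exact: measurable_maxr.
Qed.

End tensor.

Lemma ln2_gt0 (R : realType) : 0 < ln 2 :> R. Proof. by rewrite ln_gt0// ltr1n. Qed.

Lemma ln2_le1 (R : realType) : ln 2 <= 1 :> R.
Proof. by apply: (@le_ln1Dx R 1); rewrite (lt_trans _ ltr01)// oppr_lt0. Qed.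

Section fixed_size.
Context d (T : measurableType d) (R : realType) (P : probability T R).
Variables (n p : nat) (J : multi_index n p -> {RV P >-> R}).
Hypothesis n2 : (2 <= n)%N.
Hypothesis Jind : mutually_independent J.
Hypothesis Jnorm : forall i, standard_normal (J i).
Let N : R := (n ^ p)%:R.
Let S s w : R := \sum_i spin_prod R s i * J i w.

Let n0 : (0 < n)%N. Proof. exact: leq_trans n2. Qed.
Let N0 : 0 < N. Proof. by rewrite ltr0n expn_gt0 n0. Qed.
Let nR0 : 0 < n%:R :> R. Proof. by rewrite ltr0n. Qed.
Let card0 : (0 < #|multi_index n p|)%N.
Proof. by rewrite card_multi_index expn_gt0 n0. Qed.

Let mS s : measurable_fun setT (S s).
Proof. by apply: measurable_sum => i; exact: measurable_funM. Qed.

Let lawS s (C : set R) : measurable C -> P (S s @^-1` C) = gauss_prob N C.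
Proof.
move=> mC.
have := signed_sum_law Jind Jnorm (norm_spin_prod R s) card0 mC.
by rewrite {1}card_multi_index.
Qed.

Let mpre s (C : set R) : measurable C -> measurable (S s @^-1` C).
Proof. by move=> mC; rewrite -[X in measurable X]setTI; exact: mS. Qed.

(* the critical energy, in units of the standard deviation of [S s] *)
Let tmax : R := Num.sqrt (2 * ln 2) * Num.sqrt n%:R.

Let tmax_gt0 : 0 < tmax.
Proof. by rewrite mulr_gt0// sqrtr_gt0// mulr_gt0// ln2_gt0. Qed.

Let above s : set T := S s @^-1` `](tmax * Num.sqrt N)%R, +oo[.

(** Union bound for the maximum from above. *)
Lemma prob_sum_above : (P (\bigcup_s above s) <= (tmax^-1)%:E)%E.
Proof.
have -> : tmax^-1 = #|config n|%:R * (expR (- tmax ^+ 2 / 2) / tmax).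
  rewrite card_config natrX mulrA (_ : - tmax ^+ 2 / 2 = - (n%:R * ln 2)).
    by rewrite expRN expRM_natl lnK ?posrE// divff ?mul1r// expf_neq0.
  rewrite /tmax exprMn !sqr_sqrtr ?(ltW nR0) ?mulr_ge0 ?(ltW (ln2_gt0 R))//; by field.
apply: prob_bigcup_fin_le => s; first exact: mpre.
by rewrite lawS//; exact: gauss_prob_tail.
Qed.

Section window.
Variables (eta t : R).
Hypothesis eta01 : 0 < eta <= 1.
Let r0 : R := 1 - eta ^+ 2 / 4.
Hypothesis p8 : (8 <= p)%N.
Hypothesis pr0 : 3 * r0 ^+ (p - 2) <= 1 / 12.
Hypothesis t0 : 0 < t.
Hypothesis wn : (t + 1) ^+ 2 / 2 <= n%:R * (ln 2 - 2 * eta).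

Let W : set R := `[(t * Num.sqrt N)%R, ((t + 1) * Num.sqrt N)%R]%classic.
Let inW s : set T := S s @^-1` W.

Let mW : measurable W. Proof. exact: measurable_itv. Qed.

Let r01 : 0 <= r0 < 1.
Proof. by have /andP[e0 e1] := eta01; rewrite /r0; nra. Qed.

Let q : R := fine (gauss_prob N W).

Let qE : gauss_prob N W = q%:E.
Proof. by rewrite fineK// fin_num_measure. Qed.

Let q_ge : expR (- (t + 1) ^+ 2 / 2) / 3 <= q.
Proof. by have := gauss_prob_window_ge N0 t0; rewrite -/W qE lee_fin. Qed.

Let q_gt0 : 0 < q.
Proof. by apply: lt_le_trans q_ge; rewrite divr_gt0 ?expR_gt0. Qed.

Lemma prob_pair_window s s' :
  (P (inW s `&` inW s') <=
   (pair_weight n p eta (t + 1) (overlap R s s') * q ^+ 2)%:E)%E.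
Proof.
have /andP[r00 /ltW r01'] := r01.
have Psq : P (inW s) = q%:E by rewrite -qE -(lawS s).
rewrite /pair_weight -/r0; case: ifPn => [Dr|_]; last first.
  apply: (@le_trans _ _ (P (inW s))).
    apply: le_measure; rewrite ?inE; [|exact: mpre|exact: subIsetl].
    by apply: measurableI; exact: mpre.
  rewrite Psq lee_fin expr2 mulrA ler_peMl ?(ltW q_gt0)//.
  have : 3 * expR ((t + 1) ^+ 2 / 2) * (expR (- (t + 1) ^+ 2 / 2) / 3) = 1.
    rewrite [LHS](_ : _ = expR ((t + 1) ^+ 2 / 2) * expR (- (t + 1) ^+ 2 / 2)).
      by rewrite -expRD mulNr addrN expR0.
    by field.
  by move=> e1; rewrite -[leLHS]e1 ler_wpM2l ?mulr_ge0 ?expR_ge0.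
have NE : #|multi_index n p|%:R = N by rewrite card_multi_index.
have DE : `|\sum_(i : multi_index n p) spin_prod R s i * spin_prod R s' i| /
    #|multi_index n p|%:R = (`|overlap R s s'| / n%:R) ^+ p.
  by rewrite sum_spin_prodM NE normrX expr_div_n /N natrX.
set x := `|_| / n%:R in Dr DE *.
have x0 : 0 <= x by rewrite divr_ge0.
have xp : x ^+ p <= 1 / 2.
  apply: (@le_trans _ _ (r0 ^+ (p - 2))); last by move: pr0; set y := r0 ^+ _ => h; lra.
  apply: (@le_trans _ _ (r0 ^+ p)); first by apply: lerXn2r; rewrite ?nnegrE.
  by apply: ler_wiXn2l => //; exact: leq_subr.
have := @signed_sum_pair _ _ _ _ _ J Jind Jnorm _ _ (norm_spin_prod R s)
  (norm_spin_prod R s') t W (ltW t0).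
rewrite DE NE => /(_ xp card0 erefl) /le_trans; apply.
rewrite qE -(EFinM q q) -EFinM lee_fin -expr2 ler_wpM2r ?sqr_ge0// ler_expR.
rewrite ler_wpM2r ?exprn_ge0//.
have /andP[e0 _] := eta01.
have h1 : n%:R * (ln 2 - 2 * eta) <= n%:R * 1.
  by rewrite ler_wpM2l ?(ltW nR0)//; have := ln2_le1 R; lra.
have n2' : 2 <= n%:R :> R by rewrite ler_nat.
have h2 := le_trans wn h1; rewrite mulr1 in h2.
by move: ((t + 1) ^+ 2) (n%:R) h2 n2' => y m h2 n2'; lra.
Qed.

Let B : R := expR (3 / n%:R) - 1 +
  n.+1%:R * (2 * expR (- (Num.sqrt n%:R / 12))) + 6 * expR (- (eta * n%:R)).

(** Second moment bound for the event that no configuration has its energy in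
    the window. *)
Lemma prob_sum_below : (P (\bigcap_(s in [set: config n]) ~` inW s) <= B%:E)%E.
Proof.
apply: (@second_moment _ _ _ _ _ inW _ q B
    (fun s s' => pair_weight n p eta (t + 1) (overlap R s s'))) => //.
- by move=> s; exact: mpre.
- by rewrite card_config expn_gt0.
- by move=> s; rewrite -qE -(lawS s).
- exact: prob_pair_window.
have E1 : 1 + B = expR (3 / n%:R) + n.+1%:R * (2 * expR (- (Num.sqrt n%:R / 12))) +
     6 * expR (- (eta * n%:R)) by rewrite /B; ring.
rewrite exchange_big/=.
apply: (@le_trans _ _ (\sum_(s : config n) (2 ^+ n * (1 + B)))).
  by apply: ler_sum => s _; rewrite E1; exact: sum_pair_weight.
by rewrite sumr_const card_config -[leLHS]mulr_natl !natrX mulrA expr2.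
Qed.

Lemma prob_max_config_between (a : R) : a * Num.sqrt n%:R <= t ->
  ((1 - (tmax^-1 + B))%:E <=
   P [set w | a <= max_config (hamiltonian (fun i => J i w))
                <= Num.sqrt (2 * ln 2)]%R)%E.
Proof.
move=> at0.
set good := [set w | _].
have sN0 : 0 < Num.sqrt N by rewrite sqrtr_gt0.
have sn0 : 0 < Num.sqrt n%:R :> R by rewrite sqrtr_gt0.
have snN0 : 0 < Num.sqrt n%:R * Num.sqrt N by rewrite mulr_gt0.
have HE w s : hamiltonian (fun i => J i w) s * (Num.sqrt n%:R * Num.sqrt N) = S s w.
  exact: hamiltonianE.
have mH s : measurable_fun setT (fun w => hamiltonian (fun i => J i w) s).
  rewrite (_ : (fun w => _) = fun w => (Num.sqrt n%:R * Num.sqrt N)^-1 * S s w).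
    by apply: measurable_funM.
  by apply/funext => w; rewrite -HE mulrCA mulVf ?mulr1// gt_eqF.
have mgood : measurable good.
  have mM := measurable_max_config mH.
  rewrite (_ : good = setT `&` (fun w => max_config (hamiltonian (fun i => J i w))) @^-1`
      `[a, Num.sqrt (2 * ln 2)]%classic).
    by apply: mM => //; exact: measurable_itv.
  by rewrite setTI; apply/funext => w; rewrite /good/= in_itv.
pose bad := \bigcup_s above s `|` \bigcap_(s in [set: config n]) ~` inW s.
have fc : finite_set [set: config n] by exact: finite_finset.
have mU : measurable (\bigcup_s above s).
  by apply: fin_bigcup_measurable => // s _; exact: mpre.
have mI : measurable (\bigcap_(s in [set: config n]) ~` inW s).
  by apply: fin_bigcap_measurable => // s _; apply: measurableC; exact: mpre.
have mbad : measurable bad by exact: measurableU.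
have Pbad : (P bad <= (tmax^-1 + B)%:E)%E.
  apply: (le_trans (measureU2 _ mU mI)); rewrite EFinD.
  exact: leeD prob_sum_above prob_sum_below.
apply: (@le_trans _ _ (P (~` bad))).
  by rewrite probability_setC// EFinB; exact: leeB.
apply: le_measure; rewrite ?inE//; first exact: measurableC.
move=> w nbad; rewrite /good/=; apply/andP; split.
- have [s sW] : exists s, inW s w.
    apply: contrapT => nW; apply: nbad; right => s _ sW; apply: nW; by exists s.
  apply: (le_trans _ (le_max_config _ s)).
  rewrite -(ler_pM2r snN0) HE mulrA.
  move: sW; rewrite /inW /W/= in_itv/= => /andP[+ _]; apply: le_trans.
  by rewrite ler_wpM2r ?(ltW sN0).
apply: max_config_le => s; rewrite leNgt; apply/negP => Hs.
apply: nbad; left; exists s => //; rewrite /above/= in_itv/= andbT.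
by rewrite -HE /tmax -mulrA ltr_pM2r.
Qed.

End window.

End fixed_size.

(** * Letting the size tend to infinity *)

Section rate.
Variable R : realType.

Lemma expr_eventually_le (r delta : R) : 0 <= r < 1 -> 0 < delta ->
  exists k : nat, forall m, (k <= m)%N -> r ^+ m <= delta.
Proof.
move=> /andP[r0 r1] d0.
have : (fun m => r ^+ m) @ \oo --> (0 : R) by apply: cvg_expr; rewrite ger0_norm.
move/cvgr0Pnorm_le => /(_ _ d0) [k _ kP]; exists k => m km.
by have := kP m km; rewrite /= ger0_norm// exprn_ge0.
Qed.

Lemma cvg_threshold_sqrt (M C : R) : 0 <= C ->
  (fun n : nat => if M <= n%:R then C / Num.sqrt n%:R else 1) @ \oo --> (0 : R).
Proof.
move=> C0; apply/cvgr0Pnorm_le => e e0.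
near=> n.
have Mn : M <= n%:R by near: n; exact: nbhs_infty_ger.
have nC : (C / e) ^+ 2 <= n%:R by near: n; exact: nbhs_infty_ger.
have n1 : 1 <= n%:R :> R by near: n; exact: nbhs_infty_ger.
have s0 : 0 < Num.sqrt n%:R :> R by rewrite sqrtr_gt0 (lt_le_trans ltr01).
rewrite Mn ger0_norm ?divr_ge0 ?(ltW s0)//.
rewrite ler_pdivrMr// mulrC -ler_pdivrMr//.
rewrite -[leLHS]ger0_norm ?divr_ge0 ?(ltW e0)// -sqrtr_sqr.
exact: ler_wsqrtr.
Unshelve. all: by end_near. Qed.

(** All error terms of [prob_max_config_between] are bounded by a multiple of
    [(Num.sqrt n%:R)^-1], so that a single explicit rate serves for all [p]. *)
Lemma deviation_bound_le (n : nat) (eta : R) : 0 < eta -> (6 <= n)%N ->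
  (Num.sqrt (2 * ln 2) * Num.sqrt n%:R)^-1 +
   (expR (3 / n%:R) - 1 + n.+1%:R * (2 * expR (- (Num.sqrt n%:R / 12))) +
    6 * expR (- (eta * n%:R))) <=
  ((Num.sqrt (2 * ln 2))^-1 + 6 + 4 * 48 ^+ 4 + 6 / eta) / Num.sqrt n%:R.
Proof.
move=> e0 n6.
have n6' : 6 <= n%:R :> R by rewrite ler_nat.
have n0 : 0 < n%:R :> R by lra.
set s := Num.sqrt n%:R.
have s0 : 0 < s by rewrite sqrtr_gt0.
have ns : n%:R = s ^+ 2 by rewrite sqr_sqrtr ?(ltW n0).
have s1 : 1 <= s by rewrite -sqrtr1 ler_wsqrtr//; lra.
have sn : n%:R^-1 <= s^-1 by rewrite lef_pV2 ?posrE// ns; nra.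
have h1 : expR (3 / n%:R) - 1 <= 6 / s.
  have x0 : 0 < 3 / n%:R :> R by rewrite divr_gt0.
  have x1 : 3 / n%:R <= 1 / 2 :> R by rewrite ler_pdivrMr//; lra.
  apply: (@le_trans _ _ (2 * (3 / n%:R))); last first.
    by rewrite mulrA -natrM ler_wpM2l.
  move: (3 / n%:R) x0 x1 => x x0 x1.
  have e1 : expR x * (1 - x) <= 1.
    apply: (@le_trans _ _ (expR x * expR (- x))).
      by rewrite ler_wpM2l ?expR_ge0// expR_ge1Dx.
    by rewrite -expRD subrr expR0.
  nra.
have h2 : n.+1%:R * (2 * expR (- (s / 12))) <= 4 * 48 ^+ 4 / s.
  (* the fourth power of the linear bound on [expR] wins a factor [n ^- 2] *)
  have -> : s / 12 = 4%:R * (s / 48) by field.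
  rewrite expRN expRM_natl.
  have h : (s / 48) ^+ 4 <= expR (s / 48) ^+ 4.
    apply: lerXn2r; rewrite ?nnegrE ?expR_ge0 ?divr_ge0 ?(ltW s0)//.
    by apply: le_trans (expR_ge1Dx _); rewrite lerDr.
  have h' : (expR (s / 48) ^+ 4)^-1 <= 48 ^+ 4 * (n%:R^-1 * n%:R^-1).
    rewrite -invfM -[48 ^+ 4]invrK -invfM.
    rewrite lef_pV2 ?posrE ?mulr_gt0 ?invr_gt0 ?exprn_gt0 ?expR_gt0//.
    apply: le_trans h; rewrite expr_div_n ns -exprD mulrC.
    by [].
  apply: (@le_trans _ _ (2 * n%:R * (2 * (48 ^+ 4 * (n%:R^-1 * n%:R^-1))))).
    apply: ler_pM => //.
    - by rewrite -natr1; lra.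
    - by rewrite ler_wpM2l.
  have -> : 2 * n%:R * (2 * (48 ^+ 4 * (n%:R^-1 * n%:R^-1))) = 4 * 48 ^+ 4 * n%:R^-1 :> R.
    by field; rewrite gt_eqF.
  by rewrite ler_wpM2l// mulr_ge0 ?exprn_ge0.
have h3 : 6 * expR (- (eta * n%:R)) <= 6 / eta / s.
  rewrite -mulrA ler_wpM2l// expRN.
  apply: (@le_trans _ _ (eta * n%:R)^-1).
    rewrite lef_pV2 ?posrE ?expR_gt0 ?mulr_gt0//.
    by apply: le_trans (expR_ge1Dx _); rewrite lerDr.
  by rewrite invfM ler_wpM2l ?invr_ge0 ?(ltW e0).
rewrite invfM; move: (Num.sqrt (2 * ln 2))^-1 => a.
have -> : (a + 6 + 4 * 48 ^+ 4 + 6 / eta) / s =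
  a / s + 6 / s + 4 * 48 ^+ 4 / s + 6 / eta / s by ring.
move: (6 / s) (_ * 48 ^+ 4 / s) (6 / eta / s) h1 h2 h3 => x y z h1 h2 h3.
lra.
Qed.

End rate.

Theorem corollary2p2 (R : realType) (eps : R) (heps : 0 < eps) :
  exists P0 : nat, forall p : nat, (2 <= p)%N -> (P0 <= p)%N ->
  exists2 o : nat -> R, o @ \oo --> (0 : R) &
  forall (n : nat) (d : measure_display) (T : measurableType d)
    (P : probability T R) (J : multi_index n p -> {RV P >-> R}),
  (0 < n)%N ->
  mutually_independent J ->
  (forall i, standard_normal (J i)) ->
  ((1 - o n)%:E <=
   P [set w | (1 - eps) * Num.sqrt (2 * ln 2)
                <= max_config (hamiltonian (fun i => J i w))
                <= Num.sqrt (2 * ln 2)]%R)%E.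
Proof.
(* a smaller [eps] makes the claim stronger; the cap keeps the threshold positive *)
pose e : R := Num.min eps (1 / 2).
have e0 : 0 < e by rewrite lt_min heps/=.
have e2 : e <= 1 / 2 by rewrite ge_min lexx orbT.
have eeps : e <= eps by rewrite ge_min lexx.
have l0 := ln2_gt0 R; have l1 := ln2_le1 R.
pose eta : R := e * ln 2 / 4.
have eta0 : 0 < eta by rewrite divr_gt0// mulr_gt0.
have eta1 : eta <= 1 by rewrite /eta; nra.
have eta01 : 0 < eta <= 1 by rewrite eta0.
have r01 : 0 <= 1 - eta ^+ 2 / 4 < 1.
  by apply/andP; split; [nra|rewrite ltrBlDr ltrDl divr_gt0// exprn_gt0].
have d0 : 0 < 1 / 36 :> R by [].
have [k kP] := expr_eventually_le r01 d0.
(* for [p >= 8], [n * (D / n) ^+ p] tends to 0 for overlaps [D] up to the power 3/4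
   of [n] *)
exists (maxn 8 (k + 2)) => p _; rewrite geq_max => /andP[p8 kp].
have pr0 : 3 * (1 - eta ^+ 2 / 4) ^+ (p - 2) <= 1 / 12.
  have /kP : (k <= p - 2)%N by rewrite -(addnK 2 k) leq_sub2r.
  by move: (_ ^+ (p - 2)) => y; lra.
pose M : R := Num.max (4 / eta ^+ 2) 6.
pose C : R := (Num.sqrt (2 * ln 2))^-1 + 6 + 4 * 48 ^+ 4 + 6 / eta.
have C0 : 0 <= C.
  apply: addr_ge0; last by rewrite divr_ge0// ltW.
  by apply: addr_ge0; rewrite ?mulr_ge0 ?exprn_ge0// addr_ge0 ?invr_ge0 ?sqrtr_ge0.
exists (fun n => if M <= n%:R then C / Num.sqrt n%:R else 1).
  exact: cvg_threshold_sqrt.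
move=> n d T P J n0 Jind Jnorm.
case: ifPn => [|_]; last by rewrite subrr measure_ge0.
rewrite ge_max => /andP[nM]; rewrite ler_nat => n6.
have n2 : (2 <= n)%N by exact: leq_trans n6.
set s := Num.sqrt n%:R.
have nR0 : 0 < n%:R :> R by rewrite ltr0n.
have s0 : 0 < s by rewrite sqrtr_gt0.
have ns : n%:R = s ^+ 2 by rewrite sqr_sqrtr ?(ltW nR0).
have s1 : 1 <= s by rewrite -sqrtr1 ler_wsqrtr// ler1n.
have es : 2 <= eta * s.
  have : 2 ^+ 2 <= (eta * s) ^+ 2.
    by rewrite exprMn -ns mulrC -ler_pdivrMr ?exprn_gt0// -natrX.
  by rewrite ler_sqr ?nnegrE// (mulr_ge0 (ltW eta0) (ltW s0)).
set b := Num.sqrt (2 * ln 2).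
have b0 : 0 < b by rewrite sqrtr_gt0 mulr_gt0.
have bb : b ^+ 2 = 2 * ln 2 by rewrite sqr_sqrtr// mulr_ge0// ltW.
have b2 : b <= 2 by nra.
(* the lower end of the window, in units of the standard deviation *)
pose t := (1 - e) * b * s.
have t0 : 0 < t by rewrite /t !mulr_gt0// subr_gt0; lra.
have wn : (t + 1) ^+ 2 / 2 <= n%:R * (ln 2 - 2 * eta).
  have t2 : t ^+ 2 / 2 <= n%:R * (ln 2 - 4 * eta).
    rewrite /t !exprMn bb -ns (_ : _ / 2 = n%:R * (ln 2 * (1 - e) ^+ 2)); last by field.
    rewrite ler_wpM2l ?(ltW nR0)// /eta.
    rewrite [leRHS](_ : _ = ln 2 * (1 - e)); last by field.
    by rewrite ler_wpM2l ?(ltW l0)//; nra.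
  have ts : t <= 2 * s.
    by rewrite /t ler_wpM2r ?(ltW s0)//; nra.
  have en : 2 * s + 1 / 2 <= 2 * eta * n%:R by rewrite ns; nra.
  move: (n%:R) t2 en => m t2 en; rewrite mulrBr in t2 *.
  nra.
have at0 : (1 - eps) * b * s <= t.
  by rewrite /t ler_wpM2r ?(ltW s0)// ler_wpM2r ?(ltW b0)// lerD2l lerN2.
apply: le_trans (prob_max_config_between n2 Jind Jnorm eta01 p8 pr0 t0 wn at0).
by rewrite lee_fin lerD2l lerN2; exact: deviation_bound_le.
Qed.
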